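(* Let $\boldsymbol{n}_1,\dots,\boldsymbol{n}_5\in\mathbb{R}^3$ be the unit vectors $$\boldsymbol{n}_1=(0,0,-1),\quad \boldsymbol{n}_2=\Bigl(\tfrac{1}{\sqrt2},0,\tfrac{1}{\sqrt2}\Bigr),\quad \boldsymbol{n}_3=\Bigl(-\tfrac{1}{\sqrt2},0,\tfrac{1}{\sqrt2}\Bigr),\quad \boldsymbol{n}_4=\Bigl(0,\tfrac{1}{\sqrt2},\tfrac{1}{\sqrt2}\Bigr),\quad \boldsymbol{n}_5=\Bigl(0,-\tfrac{1}{\sqrt2},\tfrac{1}{\sqrt2}\Bigr).$$ Let $\mathscr{L}(\boldsymbol{n}_1,\dots,\boldsymbol{n}_5)\subset\mathbb{R}^5$ be the set of all points $(L_1,\dots,L_5)\in\mathbb{R}^5$ with the following property: there exists a convex polytope $P\subset\mathbb{R}^3$ such that the vectors $\boldsymbol{n}_1,\dots,\boldsymbol{n}_5$ (and no other vector) are the unit outward normals to the faces of $P$, and $L_k$ is the perimeter of the face of $P$ with the outward normal $\boldsymbol{n}_k$ for every $k=1,\dots,5$. Then the set $\mathscr{L}(\boldsymbol{n}_1,\dots,\boldsymbol{n}_5)\subset\mathbb{R}^5$ is not locally-analytic.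
   Context: A convex polytope is the convex hull of a finite number of points. ''Face'' means a 2-dimensional face. For a polytope $P\subset\mathbb{R}^3$ and a unit vector $\boldsymbol{n}$, let $P^{\boldsymbol{n}}$ be the intersection of $P$ with its support plane with outward normal $\boldsymbol{n}$; the vector $\boldsymbol{n}$ is the unit outward normal to a face of $P$ when $P^{\boldsymbol{n}}$ has dimension 2, and that face is then $P^{\boldsymbol{n}}$. A set $B\subset\mathbb{R}^d$ is called analytic if $B=\{x\in\mathbb{R}^d:\varphi(x)=0\}$ for some real-analytic function $\varphi:\mathbb{R}^d\to\mathbb{R}$. A set $B\subset\mathbb{R}^d$ is called locally-analytic if for every $x\in B$ there is a neighborhood $U\subset\mathbb{R}^d$ of $x$ and an analytic set $B_0\subset\mathbb{R}^d$ such that $B\cap U=B_0\cap U$. *)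

(* Defs.v *)
From HB Require Import structures.
From mathcomp Require Import all_boot all_order all_algebra.
From mathcomp Require Import all_classical all_reals all_analysis.
Set Implicit Arguments.
Unset Strict Implicit.
Unset Printing Implicit Defensive.
Import Order.TTheory GRing.Theory Num.Theory.
Import numFieldNormedType.Exports.
Local Open Scope classical_set_scope.
Local Open Scope ring_scope.

Definition dot (R : realType) (d : nat) (u v : 'rV[R]_d) : R :=
  \sum_(i < d) u 0 i * v 0 i.

(* The library norm on ['rV[R]_d] is the sup norm, hence a separate Euclidean
   norm. *)
Definition enorm (R : realType) (d : nat) (u : 'rV[R]_d) : R :=
  Num.sqrt (dot u u).

Definition convex_hull (R : realType) (d : nat) (A : set 'rV[R]_d) :
    set 'rV[R]_d :=
  smallest (fun B => convex_set (B : set (convex_lmodType 'rV[R]_d))) A.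

Definition is_polytope (R : realType) (d : nat) (P : set 'rV[R]_d) : Prop :=
  exists2 A : set 'rV[R]_d, finite_set A & P = convex_hull A.

Definition affine_hull (R : realType) (d : nat) (A : set 'rV[R]_d) :
    set 'rV[R]_d :=
  [set x | exists m (p : 'I_m -> 'rV[R]_d) (w : 'I_m -> R),
     [/\ forall i, A (p i), \sum_(i < m) w i = 1 &
         x = \sum_(i < m) w i *: p i]].

(* The empty set has no dimension. *)
Definition has_dim (R : realType) (d : nat) (A : set 'rV[R]_d) (k : nat) :
    Prop :=
  exists x (V : {vspace 'rV[R]_d}),
    affine_hull A = [set y | y - x \in V] /\ \dim V = k.

Definition support_plane (R : realType) (d : nat) (P : set 'rV[R]_d)
    (n : 'rV[R]_d) : set 'rV[R]_d :=
  [set x | dot n x = sup [set dot n y | y in P]].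

Definition support_face (R : realType) (d : nat) (P : set 'rV[R]_d)
    (n : 'rV[R]_d) : set 'rV[R]_d :=
  P `&` support_plane P n.

Definition face_normal (R : realType) (P : set 'rV[R]_3) (n : 'rV[R]_3) :
    Prop :=
  enorm n = 1 /\ has_dim (support_face P n) 2.

(* [u] ranges over all directions of the ambient space; for a planar [F] this
   yields the same sides as the directions parallel to the plane of [F]. *)
Definition edges (R : realType) (F : set 'rV[R]_3) : set (set 'rV[R]_3) :=
  [set E | has_dim E 1 /\ exists2 u, enorm u = 1 & E = support_face F u].

(* The length of a segment, as its diameter. *)
Definition edge_length (R : realType) (E : set 'rV[R]_3) : R :=
  sup [set enorm (x - y) | x in E & y in E].

(* A finitely supported sum equals 0 when its support is infinite; a polytope
   has finitely many edges, so this does not occur for faces of polytopes. *)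
Definition perimeter (R : realType) (F : set 'rV[R]_3) : R :=
  \sum_(E \in edges F) edge_length E.

Definition perimeter_set (R : realType) (m : nat) (n : 'I_m -> 'rV[R]_3) :
    set 'rV[R]_m :=
  [set L | exists P : set 'rV[R]_3,
     [/\ is_polytope P,
         [set u | face_normal P u] = range n &
         forall k, L 0 k = perimeter (support_face P (n k))]].

Definition monomial_term (R : realType) (d : nat)
    (c : {ffun 'I_d -> nat} -> R) (h : 'rV[R]_d) (al : {ffun 'I_d -> nat}) :
    R :=
  c al * \prod_(i < d) h 0 i ^+ al i.

(* The series over all multi-indices converges absolutely to [s]; in view of the
   absolute convergence, the sum can be computed along the boxes [0, N)^d. *)
Definition power_series_sum (R : realType) (d : nat)
    (c : {ffun 'I_d -> nat} -> R) (h : 'rV[R]_d) (s : R) : Prop :=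
  summable [set: {ffun 'I_d -> nat}] (fun al => (monomial_term c h al)%:E) /\
  (fun N : nat => \sum_(b : {ffun 'I_d -> 'I_N})
                    monomial_term c h [ffun i => b i : nat]) @ \oo --> s.

Definition real_analytic (R : realType) (d : nat) (phi : 'rV[R]_d -> R) :
    Prop :=
  forall a : 'rV[R]_d, exists c : {ffun 'I_d -> nat} -> R,
    \forall x \near a, power_series_sum c (x - a) (phi x).

Definition analytic_set (R : realType) (d : nat) (B : set 'rV[R]_d) : Prop :=
  exists2 phi : 'rV[R]_d -> R, real_analytic phi & B = [set x | phi x = 0].

Definition locally_analytic (R : realType) (d : nat) (B : set 'rV[R]_d) :
    Prop :=
  forall x, B x -> exists U B0 : set 'rV[R]_d,
    [/\ nbhs x U, analytic_set B0 & B `&` U = B0 `&` U].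

Definition vec3 (R : realType) (x y z : R) : 'rV[R]_3 :=
  \row_(i < 3) [:: x; y; z]`_i.

Definition normals (R : realType) (k : 'I_5) : 'rV[R]_3 :=
  let s := (Num.sqrt 2)^-1 in
  [:: vec3 0 0 (- 1); vec3 s 0 s; vec3 (- s) 0 s; vec3 0 s s;
      vec3 0 (- s) s]`_k.

(* Main.v *)
Require Import Defs.
From mathcomp Require Import all_boot all_order all_algebra.
From mathcomp Require Import all_classical all_reals all_analysis.
From mathcomp Require Import ring lra.
Set Implicit Arguments.
Unset Strict Implicit.
Unset Printing Implicit Defensive.
Import Order.TTheory GRing.Theory Num.Theory.
Import numFieldNormedType.Exports.
Local Open Scope classical_set_scope.
Local Open Scope ring_scope.

(** Up to translation, a polytope with these five facet normals is a hip roof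
    with slopes of 45 degrees over a rectangle with half-sides [a] and [b]
    ([polytope_roof]). If [b <= a], the ridge is parallel to the longer sides,
    the four slanted edges have length [b] times the square root of 3, and the
    five perimeters are linear in [(a, b)] ([roof_perimeters]). If [a <= b], the
    roles of the two directions are exchanged. So the set of perimeters is the
    union of two plane sectors, which meet along the ray of pyramids, [a = b].

    The sectors do not lie in the same plane. The line that starts at the pyramid
    [a = b = 1] in the direction of growing [a] stays in the first sector for
    [t >= 0], and for [t < 0] it is in neither sector: there the values of the
    first, second and fourth perimeters are incompatible. If the set were the
    zero set of an analytic function near this pyramid, the function would vanish
    on the half-line, hence on both sides of the pyramid by the identity
    principle ([real_analytic_line_eq0]), a contradiction.

    The geometric part relies on two facts. First, a solid polytope is the
    intersection of the half-spaces of its facets ([polytope_halfspaces]); the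
    proof separates a point from the polytope by a plane, which is a point of the
    polar, and pushes it to a vertex of the polar, which is a facet. Second, faces
    and edges are read off from vertices: the support face of the hull of a finite
    set is the hull of the maximizing points ([support_face_hull]). This
    determines the sides of triangles and of quadrangles whose diagonals cross
    ([triangle_perimeter], [quadrangle_perimeter]), the only faces that occur. *)

(** * The Euclidean inner product *)

Section InnerProduct.
Context (R : realType) (d : nat).
Implicit Types (u v w : 'rV[R]_d) (t : R).

Lemma dotC u v : dot u v = dot v u.
Proof. by apply: eq_bigr => i _; rewrite mulrC. Qed.

Lemma dotDr u v w : dot u (v + w) = dot u v + dot u w.
Proof. by rewrite -big_split; apply: eq_bigr => i _; rewrite mxE mulrDr. Qed.

Lemma dotZr u t v : dot u (t *: v) = t * dot u v.
Proof. by rewrite mulr_sumr; apply: eq_bigr => i _; rewrite mxE mulrCA. Qed.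

Lemma dotNr u v : dot u (- v) = - dot u v.
Proof. by rewrite -scaleN1r dotZr mulN1r. Qed.

Lemma dotBr u v w : dot u (v - w) = dot u v - dot u w.
Proof. by rewrite dotDr dotNr. Qed.

Lemma dot0r u : dot u 0 = 0.
Proof. by rewrite -(scale0r 0) dotZr mul0r. Qed.

Lemma dotDl u v w : dot (v + w) u = dot v u + dot w u.
Proof. by rewrite ![dot _ u]dotC dotDr. Qed.

Lemma dotZl u t v : dot (t *: v) u = t * dot v u.
Proof. by rewrite ![dot _ u]dotC dotZr. Qed.

Lemma dotNl u v : dot (- v) u = - dot v u.
Proof. by rewrite ![dot _ u]dotC dotNr. Qed.

Lemma dotBl u v w : dot (v - w) u = dot v u - dot w u.
Proof. by rewrite dotDl dotNl. Qed.

Lemma dot_sumr (I : Type) (r : seq I) (P : pred I) (f : I -> 'rV[R]_d) u :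
  dot u (\sum_(i <- r | P i) f i) = \sum_(i <- r | P i) dot u (f i).
Proof. by apply: (big_morph (dot u)) => [v w|]; rewrite ?dotDr ?dot0r. Qed.

Lemma dotvv_ge0 u : 0 <= dot u u.
Proof. by apply: sumr_ge0 => i _; rewrite -expr2 sqr_ge0. Qed.

Lemma dotvv_eq0 u : (dot u u == 0) = (u == 0).
Proof.
apply/idP/eqP => [|->]; last by rewrite dot0r.
rewrite psumr_eq0 => [/allP u0|i _]; last by rewrite -expr2 sqr_ge0.
apply/rowP => i; rewrite mxE; apply/eqP.
by have := u0 i (mem_index_enum _); rewrite /= mulf_eq0 orbb.
Qed.

Lemma dotvv_gt0 u : u != 0 -> 0 < dot u u.
Proof. by move=> u0; rewrite lt_neqAle eq_sym dotvv_eq0 u0 dotvv_ge0. Qed.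

Lemma enormZ t u : enorm (t *: u) = `|t| * enorm u.
Proof.
by rewrite /enorm dotZl dotZr mulrA -expr2 sqrtrM ?sqr_ge0 // sqrtr_sqr.
Qed.

Lemma enorm_ge0 u : 0 <= enorm u.
Proof. exact: sqrtr_ge0. Qed.

Lemma enorm_gt0 u : u != 0 -> 0 < enorm u.
Proof. by move=> /dotvv_gt0; rewrite sqrtr_gt0. Qed.

Lemma enorm0 : enorm (0 : 'rV[R]_d) = 0.
Proof. by rewrite /enorm dot0r sqrtr0. Qed.

Lemma enorm1_neq0 u : enorm u = 1 -> u != 0.
Proof. by apply: contra_eq_neq => ->; rewrite enorm0 eq_sym oner_eq0. Qed.

Lemma enorm_normalize u : u != 0 -> enorm ((enorm u)^-1 *: u) = 1.
Proof.
move=> /enorm_gt0 u0; rewrite enormZ ger0_norm ?invr_ge0 ?ltW //.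
by rewrite mulVf // gt_eqF.
Qed.

End InnerProduct.

(** * Convex hulls of finite sequences and their support faces *)

(** Sequences make it possible to compute with vertices: a support face is the
    hull of a filtered sequence, and repetitions are harmless. *)
Definition hull (R : realType) (d : nat) (s : seq 'rV[R]_d) : set 'rV[R]_d :=
  convex_hull [set` s].

Definition is_convex (R : realType) (d : nat) (B : set 'rV[R]_d) : Prop :=
  forall x y t, 0 <= t -> t <= 1 -> B x -> B y -> B (x + t *: (y - x)).

Section ConvexHull.
Context (R : realType) (d : nat).
Implicit Types (u x y p q : 'rV[R]_d) (h k : R) (s : seq 'rV[R]_d).
Implicit Types (B : set 'rV[R]_d).

Lemma convex_setP B :
  convex_set (B : set (convex_lmodType 'rV[R]_d)) <-> is_convex B.
Proof.
split=> cB x y.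
  move=> t t0 t1 Bx By.
  have t01 : Itv.spec (@Itv.num_sem R) (Itv.Real `[0%Z, 1%Z]) t.
    by rewrite /Itv.spec /= /Itv.num_sem /= num_real in_itv /= t0 t1.
  have := cB y x (Itv.mk t01) (mem_set By) (mem_set Bx).
  move/set_mem; congr B.
  rewrite /convex.conv /=.
  by rewrite scalerBl scalerBr scale1r addrCA.
move=> l /set_mem Bx /set_mem By; apply/mem_set.
have := cB y x l%:num _ _ By Bx; rewrite ge0 le1 => /(_ erefl erefl).
congr B; rewrite /convex.conv /=.
by rewrite scalerBl scalerBr scale1r addrCA.
Qed.

Lemma hull_convex s : is_convex (hull s).
Proof.
apply/convex_setP => x y l /set_mem xs /set_mem ys; apply/mem_set => B BP.
have [cB _] := BP.
by apply/set_mem/cB; apply/mem_set; [exact: xs|exact: ys].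
Qed.

Lemma mem_hull s p : p \in s -> hull s p.
Proof. by move=> ps B [_]; apply. Qed.

Lemma hull_min s B : is_convex B -> (forall p, p \in s -> B p) -> hull s `<=` B.
Proof. by move=> /convex_setP cB sB; apply: smallest_sub. Qed.

Lemma eq_hull s s' : s =i s' -> hull s = hull s'.
Proof.
by move=> ss'; congr convex_hull; apply/seteqP; split=> x /=; rewrite ss'.
Qed.

Lemma hull_nil : hull [::] = set0 :> set 'rV[R]_d.
Proof. by apply/seteqP; split=> //; apply: hull_min. Qed.

Lemma hull1 p : hull [:: p] = [set p].
Proof.
apply/seteqP; split=> [|_ ->]; last by apply: mem_hull; rewrite inE.
apply: hull_min => [x y t _ _ -> ->|x]; last by rewrite inE => /eqP.
by rewrite subrr scaler0 addr0.
Qed.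

Lemma halfspace_convex u h : is_convex [set x | dot u x <= h].
Proof.
move=> x y t t0 t1 /= xh yh; rewrite dotDr dotZr dotBr.
by have := mulr_ge0 t0 (_ : 0 <= h - dot u y); nra.
Qed.

Lemma hull_le s u h :
  (forall p, p \in s -> dot u p <= h) -> forall x, hull s x -> dot u x <= h.
Proof. by move=> sh; apply: hull_min (@halfspace_convex u h) _. Qed.

Lemma hull_dot_eq s u h : (forall p, p \in s -> dot u p = h) ->
  forall p, hull s p -> dot u p = h.
Proof.
move=> sh; apply: hull_min => // p q t _ _ /= ph qh.
by rewrite dotDr dotZr dotBr ph qh subrr mulr0 addr0.
Qed.

Lemma sup_hull s u h : (forall p, p \in s -> dot u p <= h) ->
  (exists2 p, p \in s & dot u p = h) -> sup [set dot u y | y in hull s] = h.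
Proof.
move=> sh [p ps ph]; apply/eqP; rewrite eq_le; apply/andP; split.
  apply: ge_sup; first by exists (dot u p), p => //; apply: mem_hull.
  by move=> _ [x xs <-]; apply: hull_le xs.
apply: ub_le_sup; last by exists p => //; apply: mem_hull.
by exists h => _ [x xs <-]; apply: hull_le xs.
Qed.

(** The points of the hull that either lie strictly below the level of [h] or
    in the hull of the maximizing generators form a convex set: an interior
    point of a segment reaches the maximum only when both ends do. *)
Lemma support_face_hull s u h : (forall p, p \in s -> dot u p <= h) ->
  (exists2 p, p \in s & dot u p = h) ->
  support_face (hull s) u = hull [seq p <- s | dot u p == h].
Proof.
move=> sh exh; rewrite /support_face /support_plane (sup_hull sh exh).
set s' := [seq p <- s | dot u p == h].
apply/seteqP; split=> [x [xs /= xh]|x]; last first.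
  move=> xs'; split.
    apply: (hull_min (@hull_convex s)) xs' => p.
    by rewrite mem_filter => /andP[_ ps]; apply: mem_hull.
  by apply: hull_dot_eq xs' => p; rewrite mem_filter => /andP[/eqP].
suff : dot u x <= h /\ (dot u x = h -> hull s' x) by case=> _; apply.
pose B := [set y | dot u y <= h /\ (dot u y = h -> hull s' y)].
apply: (hull_min (B := B)) xs.
  move=> y z t t0 t1 [yh ys] [zh zs]; split; first exact: halfspace_convex.
  rewrite dotDr dotZr dotBr => yzh.
  have [t0'|tn0] := eqVneq t 0.
    rewrite t0' scale0r addr0; apply: ys.
    by move: yzh; rewrite t0'; lra.
  have [t1'|tn1] := eqVneq t 1.
    rewrite t1' scale1r addrC subrK; apply: zs.
    by move: yzh; rewrite t1'; lra.
  have tgt0 : 0 < t by rewrite lt_neqAle eq_sym tn0.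
  have tlt1 : t < 1 by rewrite lt_neqAle tn1.
  have [ly lz] : dot u y = h /\ dot u z = h.
    have : (1 - t) * (h - dot u y) + t * (h - dot u z) = 0 by lra.
    move/eqP; rewrite paddr_eq0; last first.
    - by rewrite mulr_ge0 // subr_ge0.
    - by rewrite mulr_ge0 ?subr_ge0.
    rewrite !mulf_eq0 !subr_eq0 (gt_eqF tgt0) (gt_eqF tlt1) /=.
    by move=> /andP[/eqP <- /eqP <-].
  by apply: hull_convex; [|exact: ltW|exact: ys|exact: zs].
move=> p ps; split; first exact: sh.
by move=> ph; apply: mem_hull; rewrite mem_filter ph eqxx.
Qed.

Lemma support_face_hullZ s u h k : 0 < k ->
  (forall p, p \in s -> dot u p <= h) -> (exists2 p, p \in s & dot u p = h) ->
  support_face (hull s) (k *: u) = hull [seq p <- s | dot u p == h].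
Proof.
move=> k0 sh [p ps ph]; rewrite (@support_face_hull _ _ (k * h)).
- congr hull; apply: eq_filter => y.
  by rewrite dotZl (inj_eq (mulfI (lt0r_neq0 k0))).
- by move=> y ys; rewrite dotZl ler_pM2l // sh.
- by exists p => //; rewrite dotZl ph.
Qed.

Lemma support_face_hull_sub s s' u h k : 0 < k -> s' != [::] ->
  all (fun p => dot u p <= h) s ->
  all (fun p => (dot u p == h) ==> (p \in s')) s ->
  all (fun p => (p \in s) && (dot u p == h)) s' ->
  support_face (hull s) (k *: u) = hull s'.
Proof.
move=> k0 s'0 /allP sh /allP ss' /allP s's.
rewrite (support_face_hullZ k0 sh); last first.
  case: s' s'0 {ss'} s's => // p s' _ /(_ p); rewrite inE eqxx => /(_ isT).
  by move=> /andP[ps /eqP ph]; exists p.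
apply: eq_hull => p; rewrite mem_filter; apply/andP/idP => [[ph ps]|ps'].
  by have := ss' p ps; rewrite ph.
by have /andP[] := s's p ps'.
Qed.

Lemma is_polytopeP (P : set 'rV[R]_d) :
  is_polytope P <-> exists s, P = hull s.
Proof.
split=> [[A /finite_seqP[s ->] ->]|[s ->]]; first by exists s.
by exists [set` s].
Qed.

End ConvexHull.

(** * Dimension of a set of points *)

Section Dimension.
Context (R : realType) (d : nat).
Implicit Types (u x y p q : 'rV[R]_d) (A : set 'rV[R]_d) (X : seq 'rV[R]_d).

Lemma sub_affine_hull A : A `<=` affine_hull A.
Proof.
move=> x Ax; exists 1%N, (fun=> x), (fun=> 1).
by split=> //; rewrite big_ord1 ?scale1r.
Qed.

Lemma affine_hull_min A x0 (W : {vspace 'rV[R]_d}) :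
  (forall y, A y -> y - x0 \in W) ->
  forall y, affine_hull A y -> y - x0 \in W.
Proof.
move=> AW _ [m [p [w [Ap w1 ->]]]].
rewrite -[x0]scale1r -w1 scaler_suml -sumrB.
by apply: memv_suml => i _; rewrite -scalerBr memvZ // AW.
Qed.

Lemma has_dim_le A k x0 (W : {vspace 'rV[R]_d}) :
  (forall y, A y -> y - x0 \in W) -> has_dim A k -> (k <= \dim W)%N.
Proof.
move=> /affine_hull_min AW [x [V [AV <-]]]; apply/dimvS/subvP => v vV.
have xW : x - x0 \in W by apply: AW; rewrite AV /= subrr mem0v.
have -> : v = (x + v - x0) - (x - x0).
  by rewrite opprB addrA subrK addrC addKr.
by rewrite memvB //; apply: AW; rewrite AV /= [x + v]addrC addrK.
Qed.

Lemma has_dim_ge A k p X : A p -> (forall e, e \in X -> A (p + e)) ->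
  free X -> has_dim A k -> (size X <= k)%N.
Proof.
move=> Ap AX fX [x [V [AV <-]]].
have inV y : A y -> y - x \in V.
  by move=> /sub_affine_hull; rewrite AV.
rewrite -(eqP fX); apply/dimvS/span_subvP => e eX.
have -> : e = (p + e - x) - (p - x).
  by rewrite opprB addrA subrK addrC addKr.
by apply: memvB; apply: inV => //; exact: AX.
Qed.

Lemma has_dim_span A p X : free X -> A p -> (forall e, e \in X -> A (p + e)) ->
  (forall y, A y -> y - p \in <<X>>%VS) -> has_dim A (size X).
Proof.
move=> fX Ap AX sub; exists p, <<X>>%VS; split; last exact/eqP.
apply/seteqP; split=> y /=; first exact: affine_hull_min.
move=> /(@coord_span _ _ _ (in_tuple X)) yE.
pose c i := coord (in_tuple X) i (y - p).
pose pt (i : 'I_(size X).+1) :=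
  if unlift ord0 i is Some j then p + X`_j else p.
pose w (i : 'I_(size X).+1) :=
  if unlift ord0 i is Some j then c j else 1 - \sum_j c j.
exists (size X).+1, pt, w; split.
- move=> i; rewrite /pt; case: unliftP => [j _|_] //.
  by apply: AX; rewrite mem_nth.
- rewrite big_ord_recl /w unlift_none.
  by under [X in _ + X]eq_bigr => j _ do rewrite liftK; rewrite subrK.
- rewrite big_ord_recl /w /pt unlift_none.
  under [X in _ + X]eq_bigr => j _ do rewrite liftK scalerDr.
  rewrite big_split /= -scaler_suml addrA -scalerDl subrK scale1r.
  by rewrite -[LHS](subrK p) addrC yE.
Qed.

Lemma has_dim_set1 p k : has_dim [set p] k -> k = 0%N.
Proof.
move=> /(@has_dim_le _ _ p 0%VS); rewrite dimv0 leqn0 => h; apply/eqP/h.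
by move=> y ->; rewrite subrr mem0v.
Qed.

Lemma has_dim_nonempty A k : has_dim A k -> exists x, A x.
Proof.
move=> [x [V [AV _]]].
have : affine_hull A x by rewrite AV /= subrr mem0v.
move=> [[|m] [p [w [Ap w1 _]]]]; last by exists (p ord0).
by move: w1; rewrite big_ord0 => /esym/eqP; rewrite oner_eq0.
Qed.

Lemma free2P p q :
  reflect (forall s t, s *: p + t *: q = 0 -> s = 0 /\ t = 0)
          (free [:: p; q]).
Proof.
apply: (iffP idP) => [/(@freeP _ _ _ [tuple p; q]) fX s t st0|fX].
  have := fX (fun i => [:: s; t]`_i); rewrite !big_ord_recl big_ord0 addr0 /=.
  by move=> /(_ st0) h; split; [exact: (h ord0)|exact: (h (lift ord0 ord0))].
apply/(@freeP _ _ _ [tuple p; q]) => k; rewrite !big_ord_recl big_ord0 addr0 /=.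
move=> /fX[k0 k1] i; case: (unliftP ord0 i) => [j ->|-> //].
by rewrite ord1.
Qed.

Lemma dot_span X u : (forall e, e \in X -> dot u e = 0) ->
  forall y, y \in <<X>>%VS -> dot u y = 0.
Proof.
move=> uX y /(@coord_span _ _ _ (in_tuple X)) ->.
rewrite dot_sumr big1 // => i _.
by rewrite dotZr uX ?mulr0 // mem_nth.
Qed.

End Dimension.

Section Space.
Context (R : realType).
Implicit Types (u w p q v : 'rV[R]_3) (A : set 'rV[R]_3) (X : seq 'rV[R]_3).

(** Two independent vectors orthogonal to [u] span the plane orthogonal to
    [u]: otherwise a third vector of that plane completes them to a basis of the
    space, and [u] is orthogonal to itself. *)
Lemma orthogonal_plane_span X u v : free X -> size X = 2 -> u != 0 ->
  (forall e, e \in X -> dot u e = 0) -> dot u v = 0 -> v \in <<X>>%VS.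
Proof.
move=> fX sX u0 uX uv; apply/negPn/negP => vX.
have fvX : free (v :: X) by rewrite free_cons vX.
have uspan : u \in <<v :: X>>%VS.
  suff -> : <<v :: X>>%VS = fullv by rewrite memvf.
  apply/eqP; rewrite eqEdim subvf dimvf (eqP fvX) /= sX.
  by rewrite /dim /= mul1n.
move: u0; rewrite -dotvv_eq0 => /eqP[]; apply: dot_span uspan => e.
by rewrite inE => /predU1P[->//|/uX].
Qed.

Lemma has_dim2_plane A p q r u h : free [:: q - p; r - p] ->
  A p -> A q -> A r -> u != 0 -> (forall y, A y -> dot u y = h) -> has_dim A 2.
Proof.
move=> fX Ap Aq Ar u0 Ah; apply: (has_dim_span fX Ap) => [e|y Ay].
  by rewrite !inE => /orP[] /eqP ->; rewrite addrC subrK.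
apply: (@orthogonal_plane_span _ u) => // [e|]; last first.
  by rewrite dotBr !Ah ?subrr.
by rewrite !inE => /orP[] /eqP ->; rewrite dotBr !Ah ?subrr.
Qed.

(** A planar set spans a single plane, so two functionals that are constant on
    it are proportional. *)
Lemma has_dim2_normal A u w h k : has_dim A 2 -> u != 0 ->
  (forall y, A y -> dot u y = h) -> (forall y, A y -> dot w y = k) ->
  forall v, dot u v = 0 -> dot w v = 0.
Proof.
move=> [x [V [AV dV]]] u0 Au Aw v uv.
have inV n m : (forall y, A y -> dot n y = m) ->
    forall e, e \in V -> dot n e = 0.
  move=> An e eV.
  have aff y : affine_hull A y -> dot n y = m.
    move=> [l [p [c [Ap c1 ->]]]]; rewrite dot_sumr -[RHS]mul1r -c1 mulr_suml.
    by apply: eq_bigr => i _; rewrite dotZr An.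
  have <- : x + e - x = e by rewrite addrC addKr.
  rewrite dotBr !aff ?subrr // AV /= ?subrr ?mem0v //.
  by rewrite addrC addKr.
apply: (inV w k) => //; rewrite -(span_basis (vbasisP V)).
apply: (@orthogonal_plane_span _ u) => //.
- exact: basis_free (vbasisP V).
- by rewrite size_tuple.
- by move=> e /vbasis_mem /(inV u h Au).
Qed.

End Space.

(** * Perimeters of triangles and convex quadrangles *)

Section Segments.
Context (R : realType).
Implicit Types (u p q x : 'rV[R]_3).

Lemma hull2P p q x :
  hull [:: p; q] x <-> exists2 t, 0 <= t <= 1 & x = p + t *: (q - p).
Proof.
split=> [|[t /andP[t0 t1] ->]]; last first.
  by apply: hull_convex => //; apply: mem_hull; rewrite !inE eqxx ?orbT.
apply: (hull_min (B := [set x | exists2 t, 0 <= t <= 1 & _])) => [|y].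
  move=> _ _ l l0 l1 [s /andP[s0 s1] ->] [t /andP[t0 t1] ->].
  exists (s + l * (t - s)).
    by apply/andP; split; nra.
  by apply/rowP => i; rewrite !mxE; ring.
rewrite !inE => /orP[] /eqP ->.
  by exists 0; rewrite ?lexx ?ler01 // scale0r addr0.
by exists 1; rewrite ?lexx ?ler01 // scale1r addrC subrK.
Qed.

Lemma has_dim_segment p q : p != q -> has_dim (hull [:: p; q]) 1.
Proof.
move=> pq; apply: (@has_dim_span _ _ _ p [:: q - p]).
- by rewrite free_cons span_nil memv0 subr_eq0 eq_sym pq nil_free.
- by apply: mem_hull; rewrite inE eqxx.
- move=> e; rewrite inE => /eqP ->; apply: mem_hull.
  by rewrite addrC subrK !inE eqxx orbT.
- move=> _ /hull2P[t _ ->]; rewrite addrC addKr memvZ //.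
  by rewrite memv_span // inE.
Qed.

Lemma segment_diameter p q x y : hull [:: p; q] x -> hull [:: p; q] y ->
  enorm (x - y) <= enorm (p - q).
Proof.
move=> /hull2P[s /andP[s0 s1] ->] /hull2P[t /andP[t0 t1] ->].
have -> : p + s *: (q - p) - (p + t *: (q - p)) = (t - s) *: (p - q).
  by apply/rowP => i; rewrite !mxE; ring.
rewrite enormZ ler_piMl ?enorm_ge0 // ler_norml; apply/andP; split; lra.
Qed.

Lemma edge_length_segment p q : edge_length (hull [:: p; q]) = enorm (p - q).
Proof.
have pqs : [set enorm (x - y) | x in hull [:: p; q] & y in hull [:: p; q]]
    (enorm (p - q)).
  by exists p; [|exists q => //]; apply: mem_hull; rewrite !inE eqxx ?orbT.
apply/eqP; rewrite eq_le; apply/andP; split.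
  apply: ge_sup; first by exists (enorm (p - q)).
  by move=> _ [x xs] [y ys <-]; apply: segment_diameter.
apply: ub_le_sup => //; exists (enorm (p - q)).
by move=> _ [x xs] [y ys <-]; apply: segment_diameter.
Qed.

End Segments.

Section Polygons.
Context (R : realType).
Implicit Types (u p q r x z : 'rV[R]_3) (s : seq 'rV[R]_3).

Lemma argmax_dot s u : s != [::] ->
  exists h, (forall x, x \in s -> dot u x <= h) /\
            (exists2 x, x \in s & dot u x = h).
Proof.
elim: s => // p [_ _|q s /(_ isT) [h [sh [x xs xh]]] _].
  exists (dot u p); split=> [x|]; first by rewrite inE => /eqP ->.
  by exists p => //; rewrite inE.
have [ph|hp] := leP (dot u p) h.
  exists h; split=> [y|]; first by rewrite inE => /predU1P[->//|/sh].
  by exists x => //; rewrite inE xs orbT.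
exists (dot u p); split=> [y|]; last by exists p => //; rewrite inE eqxx.
by rewrite inE => /predU1P[->//|/sh yh]; apply: le_trans yh (ltW hp).
Qed.

Definition is_side s p q := exists u, u != 0 /\ exists h,
  (forall x, x \in s -> dot u x <= h) /\
  [seq x <- s | dot u x == h] =i [:: p; q].

Lemma eq_is_side s s' p q : s =i s' -> is_side s p q -> is_side s' p q.
Proof.
move=> ss' [u [u0 [h [sh sE]]]]; exists u; split=> //; exists h.
split=> x; rewrite -?ss'; first exact: sh.
by rewrite -sE !mem_filter ss'.
Qed.

(** [sides] lists the sides of the polygon [hull s]: each one is cut out by a
    supporting line, and a supporting line with more than one point of contact
    cuts out one of them. Sides are ordered pairs, and the last hypothesis says
    that no side is listed in both orientations. *)
Lemma perimeter_polygon s (sides : seq ('rV[R]_3 * 'rV[R]_3)) :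
  s != [::] ->
  (forall e, e \in sides -> e.1 != e.2 /\ is_side s e.1 e.2) ->
  (forall u h, (forall x, x \in s -> dot u x <= h) ->
     (exists2 x, x \in s & dot u x = h) ->
     has_dim (hull [seq x <- s | dot u x == h]) 1 ->
     exists2 e, e \in sides & [seq x <- s | dot u x == h] =i [:: e.1; e.2]) ->
  uniq sides ->
  {in sides &, forall e e', [:: e.1; e.2] =i [:: e'.1; e'.2] -> e = e'} ->
  perimeter (hull s) = \sum_(e <- sides) enorm (e.1 - e.2).
Proof.
move=> s0 side_edge edge_side us inj_sides.
pose seg (e : 'rV[R]_3 * 'rV[R]_3) := hull [:: e.1; e.2].
have edgesE : edges (hull s) = [set` map seg sides].
  apply/seteqP; split=> E /=.
    move=> [dE [u u1 EE]]; move: dE; rewrite EE.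
    have [h [sh exh]] := argmax_dot u s0.
    rewrite (support_face_hull sh exh) => /(edge_side _ _ sh exh)[e es eE].
    by apply/mapP; exists e => //; apply: eq_hull.
  move=> /mapP[e es ->]; have [e12 [u [u0 [h [sh he]]]]] := side_edge e es.
  split; first exact: has_dim_segment.
  pose c := (enorm u)^-1; have c0 : 0 < c by rewrite invr_gt0 enorm_gt0.
  exists (c *: u); first exact: enorm_normalize.
  rewrite (support_face_hullZ c0 sh); first exact/esym/eq_hull.
  have := he e.1; rewrite inE eqxx mem_filter => /andP[/eqP eh xs].
  by exists e.1.
rewrite /perimeter edgesE -fsbig_seq; last first.
  rewrite map_inj_in_uniq // => e e' es es' ee'.
  apply: inj_sides => //.
  have [_ [u [_ [h [sh he]]]]] := side_edge e es.
  have [_ [u' [_ [h' [sh' he']]]]] := side_edge e' es'.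
  have sub a b v k : seg a = seg b -> (forall x, x \in s -> dot v x <= k) ->
      [seq x <- s | dot v x == k] =i [:: a.1; a.2] ->
      {subset [:: b.1; b.2] <= s} -> {subset [:: b.1; b.2] <= [:: a.1; a.2]}.
    move=> ab vk va bs x xb; rewrite -va mem_filter bs // andbT eq_le.
    rewrite vk ?bs //= -lerN2 -dotNl.
    have : seg a x by rewrite ab; apply: mem_hull.
    apply: hull_le => y; rewrite -va mem_filter => /andP[/eqP <- _].
    by rewrite dotNl.
  have bs a v k : [seq x <- s | dot v x == k] =i [:: a.1; a.2] ->
      {subset [:: a.1; a.2] <= s}.
    by move=> va x; rewrite -va mem_filter => /andP[].
  move=> x; apply/idP/idP.
    exact: (sub e' e u' h' (esym ee') sh' he' (bs _ _ _ he)).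
  exact: (sub e e' u h ee' sh he (bs _ _ _ he')).
by rewrite big_map; apply: eq_bigr => e _; rewrite edge_length_segment.
Qed.

Definition independent p q r := free [:: q - p; r - p].

Lemma independentP p q r :
  reflect (forall a b c, a + b + c = 0 -> a *: p + b *: q + c *: r = 0 ->
             [/\ a = 0, b = 0 & c = 0])
          (independent p q r).
Proof.
apply: (iffP (free2P _ _)) => [ind a b c abc0|ind s t].
  have -> : a = - b - c by lra.
  move=> /rowP E; have [] := ind b c; last first.
    by move=> -> ->; rewrite oppr0 addr0.
  by apply/rowP => i; have := E i; rewrite !mxE; lra.
move=> /rowP E; have [||_ -> ->//] := ind (- s - t) s t; first by lra.
by apply/rowP => i; have := E i; rewrite !mxE; lra.
Qed.

Lemma independent_rot p q r : independent p q r -> independent q r p.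
Proof.
move=> /independentP ind; apply/independentP => a b c abc E.
have [||-> -> ->//] := ind c a b; first by lra.
by rewrite -E -addrA [RHS]addrC.
Qed.

Lemma independent_neq p q r : independent p q r -> [/\ p != q, q != r & p != r].
Proof.
move=> /independentP ind; split; apply/eqP => E.
- have [||/eqP] := ind 1 (-1) 0; rewrite ?oner_eq0 //; first by lra.
  by apply/rowP => i; rewrite E !mxE; ring.
- have [||_ /eqP] := ind 0 1 (-1); rewrite ?oner_eq0 //; first by lra.
  by apply/rowP => i; rewrite E !mxE; ring.
- have [||/eqP] := ind 1 0 (-1); rewrite ?oner_eq0 //; first by lra.
  by apply/rowP => i; rewrite E !mxE; ring.
Qed.

(** Gram--Schmidt yields the normal of the side from [p] to [q] that points
    away from [r]. *)
Lemma side_normal p q r : independent p q r ->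
  exists u, [/\ u != 0, dot u q = dot u p & dot u r < dot u p].
Proof.
move=> ind; pose a := q - p; pose b := r - p.
have [pq _ _] := independent_neq ind.
have aa : 0 < dot a a by rewrite dotvv_gt0 // subr_eq0 eq_sym.
pose u := dot b a *: a - dot a a *: b.
have ua : dot u a = 0 by rewrite dotBl !dotZl; ring.
have u0 : u != 0.
  move: ind => /free2P ind; apply/eqP => E.
  have [|_ /eqP] := ind (dot b a) (- dot a a); first by rewrite scaleNr.
  by rewrite oppr_eq0 (gt_eqF aa).
have ub : dot u b < 0.
  have : 0 < dot u (dot b a *: a - dot a a *: b) by rewrite dotvv_gt0.
  by rewrite dotBr !dotZr ua mulr0 sub0r oppr_gt0 pmulr_rlt0.
exists u; split=> //; last by rewrite -subr_lt0 -dotBr.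
by apply/eqP; rewrite -subr_eq0 -dotBr ua.
Qed.

Lemma triangle_side p q r : independent p q r -> is_side [:: p; q; r] p q.
Proof.
move=> /side_normal[u [u0 uq ur]]; exists u; split=> //; exists (dot u p).
split=> [x|]; last by rewrite /= uq eqxx (lt_eqF ur).
by rewrite !inE => /or3P[] /eqP ->; rewrite ?uq // ltW.
Qed.

Lemma triangle_perimeter p q r : independent p q r ->
  perimeter (hull [:: p; q; r]) = enorm (p - q) + enorm (q - r) + enorm (r - p).
Proof.
move=> ind; have [pq qr pr] := independent_neq ind.
have neqs := (negPf pq, negPf qr, negPf pr).
rewrite (@perimeter_polygon _ [:: (p, q); (q, r); (r, p)]) //.
- by rewrite !big_cons big_nil addr0 addrA.
- move=> e; rewrite !inE => /or3P[] /eqP -> /=; split=> //.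
  + exact: triangle_side.
  + apply: (@eq_is_side [:: q; r; p]); last exact/triangle_side/independent_rot.
    by move=> x; rewrite !inE; do !case: (_ == _).
  + by rewrite eq_sym.
  + apply: (@eq_is_side [:: r; p; q]).
      by move=> x; rewrite !inE; do !case: (_ == _).
    exact/triangle_side/independent_rot/independent_rot.
- move=> u h sh [x xs xh].
  have : ~~ [&& dot u p != h, dot u q != h & dot u r != h].
    move: xs xh; rewrite !inE => /or3P[] /eqP -> /eqP ->; rewrite ?andbF //.
  rewrite /=; case: (dot u p == h); case: (dot u q == h);
    case: (dot u r == h) => //= _.
  + move=> /(has_dim_ge (p := p) _ _ ind) dim2; exfalso.
    suff: (2 <= 1)%N by [].
    apply: dim2; first by apply: mem_hull; rewrite inE eqxx.
    move=> e; rewrite !inE => /orP[] /eqP ->; apply: mem_hull;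
      by rewrite addrC subrK !inE eqxx ?orbT.
  + by move=> _; exists (p, q) => //; rewrite inE eqxx.
  + move=> _; exists (r, p); first by rewrite !inE eqxx ?orbT.
    by move=> y; rewrite !inE orbC.
  + by rewrite hull1 => /has_dim_set1.
  + by move=> _; exists (q, r) => //; rewrite !inE eqxx ?orbT.
  + by rewrite hull1 => /has_dim_set1.
  + by rewrite hull1 => /has_dim_set1.
- by rewrite /= !inE !xpair_eqE !(eq_sym r) !(eq_sym q p) !neqs.
- move=> e e'; rewrite !inE => /or3P[] /eqP -> /or3P[] /eqP -> // E;
    have := (E p, E q, E r); rewrite !inE !eqxx !(eq_sym r) !(eq_sym q p) !neqs;
    by move=> [[? ?] ?].
Qed.

(** Convex position of a quadrangle with vertices in this cyclic order,
    expressed by its diagonals. In this form it is invariant under rotation of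
    the vertices, so that a single side has to be treated. *)
Definition crossing p q r z := exists l m, [/\ 0 < l < 1, 0 < m < 1 &
  (1 - l) *: p + l *: r = (1 - m) *: q + m *: z].

Lemma crossing_rot p q r z : crossing p q r z -> crossing q r z p.
Proof.
move=> [l [m [/andP[l0 l1] m01 E]]]; exists m, (1 - l).
split=> //; first by apply/andP; split; lra.
by rewrite -E addrC subKr.
Qed.

Lemma crossing_independent p q r z : independent p q r -> crossing p q r z ->
  independent q r z.
Proof.
move=> /independentP ind [l [m [/andP[l0 l1] /andP[m0 m1] /rowP E]]].
apply/independentP => a b c abc /rowP E'.
have [||] := ind (c * (1 - l)) (m * a - c * (1 - m)) (m * b + c * l).
- have -> : a = - b - c by lra.
  ring.
- apply/rowP => i; move: (congr1 ( *%R c) (E i)) (congr1 ( *%R m) (E' i)).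
  by rewrite !mxE; lra.
- move=> /eqP; rewrite mulf_eq0 subr_eq0 (gt_eqF l1) orbF => /eqP ->.
  rewrite !mul0r subr0 addr0 => /eqP; rewrite mulf_eq0 (gt_eqF m0) => /eqP ->.
  by move=> /eqP; rewrite mulf_eq0 (gt_eqF m0) => /eqP ->.
Qed.

(** Both sides compute [h - dot u x] at the crossing point [x] of the
    diagonals. *)
Lemma crossing_dot p q r z u h : crossing p q r z ->
  exists l m, [/\ 0 < l < 1, 0 < m < 1 &
    (1 - l) * (h - dot u p) + l * (h - dot u r) =
    (1 - m) * (h - dot u q) + m * (h - dot u z)].
Proof.
move=> [l [m [l01 m01 /(congr1 (dot u)) E]]]; exists l, m; split=> //.
by move: E; rewrite !dotDr !dotZr; lra.
Qed.

Lemma quadrangle_side p q r z : independent p q r -> crossing p q r z ->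
  is_side [:: p; q; r; z] p q.
Proof.
move=> /side_normal[u [u0 uq ur]] /(crossing_dot u (dot u p)).
move=> [l [m [/andP[l0 l1] /andP[m0 m1]]]]; rewrite uq subrr !mulr0 !add0r => E.
have us : dot u z < dot u p.
  by rewrite -subr_gt0 -(pmulr_rgt0 _ m0) -E mulr_gt0 // subr_gt0.
exists u; split=> //; exists (dot u p); split=> [x|].
  by rewrite !inE => /or4P[] /eqP ->; rewrite ?uq // ltW.
by rewrite /= uq eqxx (lt_eqF ur) (lt_eqF us).
Qed.

(** If a supporting line touches both ends of a diagonal, it contains the
    crossing point and therefore touches the ends of the other diagonal. *)
Lemma crossing_argmax p q r z u h : crossing p q r z ->
  (forall x, x \in [:: p; q; r; z] -> dot u x <= h) ->
  (dot u p == h) && (dot u r == h) = (dot u q == h) && (dot u z == h).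
Proof.
move=> /(crossing_dot u h)[l [m [/andP[l0 l1] /andP[m0 m1] E]]] sh.
have ge0 x : x \in [:: p; q; r; z] -> 0 <= h - dot u x.
  by move=> /sh; rewrite subr_ge0.
have l1' : 0 < 1 - l by lra.
have m1' : 0 < 1 - m by lra.
have zero a b x y : 0 < a -> 0 < b -> 0 <= h - dot u x -> 0 <= h - dot u y ->
    (a * (h - dot u x) + b * (h - dot u y) == 0) =
    (dot u x == h) && (dot u y == h).
  move=> a0 b0 hx hy; rewrite paddr_eq0 ?mulr_ge0 // ?ltW //.
  by rewrite !mulf_eq0 (gt_eqF a0) (gt_eqF b0) !subr_eq0 /= ![h == _]eq_sym.
by rewrite -(zero _ _ p r l1' l0) 1?E ?zero // ge0 // !inE eqxx ?orbT.
Qed.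

Lemma quadrangle_perimeter p q r z : independent p q r -> crossing p q r z ->
  perimeter (hull [:: p; q; r; z]) =
  enorm (p - q) + enorm (q - r) + enorm (r - z) + enorm (z - p).
Proof.
move=> ind cr.
have cr1 := crossing_rot cr; have cr2 := crossing_rot cr1.
have cr3 := crossing_rot cr2.
have ind1 := crossing_independent ind cr.
have ind2 := crossing_independent ind1 cr1.
have ind3 := crossing_independent ind2 cr2.
have [pq qr pr] := independent_neq ind.
have [_ rs qs] := independent_neq ind1.
have [_ sp _] := independent_neq ind2.
have ps : p != z by rewrite eq_sym.
have neqs := (negPf pq, negPf qr, negPf pr, negPf rs, negPf qs, negPf ps).
rewrite (@perimeter_polygon _ [:: (p, q); (q, r); (r, z); (z, p)]) //.
- by rewrite !big_cons big_nil addr0 !addrA.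
- move=> e; rewrite !inE => /or4P[] /eqP -> /=; split=> //.
  + exact: quadrangle_side.
  + apply: (@eq_is_side [:: q; r; z; p]); last exact: quadrangle_side.
    by move=> x; rewrite !inE; do !case: (_ == _).
  + apply: (@eq_is_side [:: r; z; p; q]); last exact: quadrangle_side.
    by move=> x; rewrite !inE; do !case: (_ == _).
  + apply: (@eq_is_side [:: z; p; q; r]); last exact: quadrangle_side.
    by move=> x; rewrite !inE; do !case: (_ == _).
- move=> u h sh [x xs xh].
  have : ~~ [&& dot u p != h, dot u q != h, dot u r != h & dot u z != h].
    by move: xs xh; rewrite !inE => /or4P[] /eqP -> /eqP ->; rewrite ?andbF.
  have := crossing_argmax cr sh.
  rewrite /=; case: (dot u p == h); case: (dot u q == h);
    case: (dot u r == h); case: (dot u z == h) => //= _ _.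
  + move=> /(has_dim_ge (p := p) _ _ ind) dim2; exfalso.
    suff: (2 <= 1)%N by [].
    apply: dim2; first by apply: mem_hull; rewrite inE eqxx.
    move=> e; rewrite !inE => /orP[] /eqP ->; apply: mem_hull;
      by rewrite addrC subrK !inE eqxx ?orbT.
  + by move=> _; exists (p, q) => //; rewrite inE eqxx.
  + move=> _; exists (z, p); first by rewrite !inE eqxx ?orbT.
    by move=> y; rewrite !inE orbC.
  + by rewrite hull1 => /has_dim_set1.
  + by move=> _; exists (q, r) => //; rewrite !inE eqxx ?orbT.
  + by rewrite hull1 => /has_dim_set1.
  + by move=> _; exists (r, z) => //; rewrite !inE eqxx ?orbT.
  + by rewrite hull1 => /has_dim_set1.
  + by rewrite hull1 => /has_dim_set1.
- by rewrite /= !inE !xpair_eqE !(eq_sym z) ?(eq_sym r) ?(eq_sym q p) !neqs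
    ?andbF.
- move=> e e'; rewrite !inE => /or4P[] /eqP -> /or4P[] /eqP -> // E;
    have := (E p, E q, E r, E z);
    rewrite !inE !eqxx !(eq_sym z) ?(eq_sym r) ?(eq_sym q p) ?neqs;
    by move=> [[[? ?] ?] ?].
Qed.

End Polygons.

(** * A solid polytope is cut out by its facets *)

Section Separation.
Context (R : realType).
Implicit Types (u w x y p : 'rV[R]_3) (s : seq 'rV[R]_3).

Lemma continuous_dot (T : topologicalType) (f g : T -> 'rV[R]_3) :
  continuous f -> continuous g -> continuous (fun z => dot (f z) (g z)).
Proof.
move=> cf cg; apply: continuous_big => [|i _ z]; first exact: add_continuous.
have coord (e : T -> 'rV[R]_3) : continuous e -> e y 0 i @[y --> z] --> e z 0 i.
  move=> ce; apply: (continuous_comp (f := e) (g := fun v => v 0 i)).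
    exact: ce.
  exact: coord_continuous.
by apply: cvgM; exact: coord.
Qed.

Lemma hull_cons p s : s != [::] ->
  hull (p :: s) = (fun z : R * 'rV[R]_3 => p + z.1 *: (z.2 - p)) @`
                    (`[0, 1] `*` hull s).
Proof.
case: s => // q s _; set K := _ `*` _; apply/seteqP; split; last first.
  move=> _ [[t y] [/= + ys] <-]; rewrite in_itv /= => /andP[t0 t1].
  apply: hull_convex => //; first by apply: mem_hull; rewrite inE eqxx.
  apply: (hull_min (@hull_convex _ _ _)) ys => z zs.
  by apply: mem_hull; rewrite inE zs orbT.
apply: hull_min => [|x].
  move=> _ _ t t0 t1 [[a y] [/= + ys] <-] [[b z] [/= + zs] <-].
  rewrite !in_itv /= => /andP[a0 a1] /andP[b0 b1].
  pose e := (1 - t) * a + t * b.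
  have ta : 0 <= (1 - t) * a by rewrite mulr_ge0 // subr_ge0.
  have tb : 0 <= t * b by rewrite mulr_ge0.
  have [e0|e0] := eqVneq e 0.
    exists (0, y); first by split=> //=; rewrite in_itv /= lexx ler01.
    move/eqP: e0; rewrite paddr_eq0 // => /andP[/eqP ta0 /eqP tb0].
    apply/rowP => i; rewrite !mxE /=.
    transitivity (p 0 i + ((1 - t) * a) * (y 0 i - p 0 i)
       + (t * b) * (z 0 i - p 0 i)); last by ring.
    by rewrite ta0 tb0; ring.
  have egt0 : 0 < e by rewrite lt_neqAle eq_sym e0 addr_ge0.
  exists (e, y + (t * b / e) *: (z - y)); last first.
    by apply/rowP => i; rewrite !mxE /= /e; field.
  split=> /=; first by rewrite in_itv /= ltW //= /e; nra.
  apply: hull_convex => //; first by rewrite divr_ge0 // ltW.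
  by rewrite ler_pdivrMr // mul1r /e lerDr.
rewrite inE => /predU1P[->|xs].
  exists (0, q); last by rewrite /= scale0r addr0.
  split; first by rewrite /= in_itv /= lexx ler01.
  by apply: mem_hull; rewrite inE eqxx.
exists (1, x); last by rewrite /= scale1r addrC subrK.
by split; [rewrite /= in_itv /= lexx ler01|exact: mem_hull].
Qed.

(** Adding a vertex to a hull produces a continuous image of the product of a
    segment with that hull. *)
Lemma compact_hull s : compact (hull s).
Proof.
elim: s => [|p [|q s] IH]; first by rewrite hull_nil; exact: compact0.
  by rewrite hull1; exact: compact_set1.
rewrite hull_cons //; apply: continuous_compact; last first.
  by apply: compact_setX => //; exact: segment_compact.
apply: continuous_subspaceT => z.
apply: cvgD; first exact: cvg_cst.
by apply: cvgZ; [exact: cvg_fst|apply: cvgB; [exact: cvg_snd|exact: cvg_cst]].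
Qed.

(** The normal of the separating plane joins [x] to the nearest point of the
    hull. *)
Lemma hull_separation s x : s != [::] -> ~ hull s x ->
  exists u, forall p, p \in s -> dot u p < dot u x.
Proof.
case: s => // q s _ xs.
have qs : hull (q :: s) q by apply: mem_hull; rewrite inE eqxx.
have [y ys ymin] : exists2 y, y \in hull (q :: s) &
    forall z, z \in hull (q :: s) ->
      dot (x - y) (x - y) <= dot (x - z) (x - z).
  apply: compact_EVT_min; [by exists q|exact: compact_hull|].
  have cB : continuous (fun z : 'rV[R]_3 => x - z).
    by move=> z; apply: (@cvgB _ _ _ (nbhs z)); [exact: cvg_cst|exact: cvg_id].
  by apply: continuous_subspaceT; exact: continuous_dot.
move/set_mem: ys => ys.
have xy : 0 < dot (x - y) (x - y).
  by rewrite dotvv_gt0 // subr_eq0; apply: contra_not_neq xs => ->.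
exists (x - y) => p ps; set u := x - y.
suff : dot u (p - y) <= 0 by move: xy; rewrite -/u [X in 0 < X]dotBr dotBr; lra.
set v := p - y; rewrite leNgt; apply/negP => uv.
have vv : 0 <= dot v v := dotvv_ge0 v.
pose t := dot u v / (dot u v + dot v v).
have D : 0 < dot u v + dot v v by lra.
have t0 : 0 < t by rewrite divr_gt0.
have t1 : t <= 1 by rewrite ler_pdivrMr // mul1r lerDl.
have : hull (q :: s) (y + t *: v).
  by apply: hull_convex => //; [exact: ltW|exact: mem_hull].
move=> /mem_set/ymin.
have -> : x - (y + t *: v) = u - t *: v by rewrite opprD addrA.
have expand (a b : 'rV[R]_3) k : dot (a - k *: b) (a - k *: b) =
    dot a a - 2 * k * dot a b + k * (k * dot b b).
  by rewrite dotBr !dotBl !dotZr !dotZl [dot b a]dotC; ring.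
rewrite expand.
have tD : t * (dot u v + dot v v) = dot u v by rewrite divfK // gt_eqF.
have := congr1 ( *%R t) tD.
have tuv : 0 < t * dot u v by rewrite mulr_gt0.
have ttuv : 0 < t * (t * dot u v) by rewrite mulr_gt0.
by lra.
Qed.

End Separation.

Lemma argmin_seq (R : realType) (T : eqType) (f : T -> R) (r : seq T) :
  r != [::] -> exists2 x, x \in r & forall y, y \in r -> f x <= f y.
Proof.
elim: r => // a [_ _|b r /(_ isT)[x xr xmin] _].
  by exists a; [rewrite inE|move=> y; rewrite inE => /eqP ->].
have [ax|xa] := leP (f a) (f x).
  exists a; first by rewrite inE eqxx.
  by move=> y; rewrite inE => /predU1P[->//|/xmin]; exact: le_trans.
exists x; first by rewrite inE xr orbT.
by move=> y; rewrite inE => /predU1P[->|/xmin //]; exact: ltW.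
Qed.

Section Facets.
Context (R : realType).
Implicit Types (u w x y p c : 'rV[R]_3) (s : seq 'rV[R]_3).

Lemma exists_orthogonal s : (size s < 3)%N ->
  exists2 w, w != 0 & forall e, e \in s -> dot w e = 0.
Proof.
move=> s3; pose M : 'M[R]_(3, size s) := \matrix_(i, j) s`_j 0 i.
have /rowV0Pn[w] : kermx M != 0.
  rewrite kermx_eq0 /row_free neq_ltn (leq_ltn_trans (rank_leq_col M)) //.
move=> /sub_kermxP wM w0; exists w => // e /(nthP 0)[j js <-].
have := congr1 (fun A : 'rV_(size s) => A 0 (Ordinal js)) wM; rewrite !mxE => E.
by rewrite -[RHS]E; apply: eq_bigr => i _; rewrite mxE.
Qed.

(** Normals with origin [c] are scaled so that their supporting planes are at
    level 1: they are the points of the polar of the polytope, and the tight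
    vertices are the facets of the polar that contain the normal. *)
Definition polar s c u := forall p, p \in s -> dot u (p - c) <= 1.

Definition tight s c u := [seq p <- s | dot u (p - c) == 1].

(** As long as the tight constraints leave a direction [w] free, the normal
    can move along it, without decreasing its value at [x], until some new
    constraint becomes tight. *)
Lemma polar_push s c x u : (forall w, w != 0 -> exists2 p, p \in s &
    0 < dot w (p - c)) ->
  polar s c u -> 1 < dot u (x - c) ->
  (exists2 w, w != 0 & forall p, p \in tight s c u -> dot w (p - c) = 0) ->
  exists u', [/\ polar s c u', 1 < dot u' (x - c) &
    (size (tight s c u) < size (tight s c u'))%N].
Proof.
move=> cs us ux [w0 w00 w0t].
have {w0 w00 w0t} [w [wn0 wt wx]] : exists w, [/\ w != 0,
    forall p, p \in tight s c u -> dot w (p - c) = 0 & 0 <= dot w (x - c)].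
  have [wx|wx] := leP 0 (dot w0 (x - c)); first by exists w0.
  exists (- w0); split; rewrite ?oppr_eq0 //; last by rewrite dotNl; lra.
  by move=> p /w0t; rewrite dotNl => ->; rewrite oppr0.
pose r := [seq p <- s | 0 < dot w (p - c)].
have r0 : r != [::].
  have [p ps wp] := cs w wn0.
  have : p \in r by rewrite mem_filter wp.
  by case: r.
have [q qr qmin] :=
  argmin_seq (fun p => (1 - dot u (p - c)) / dot w (p - c)) r0.
have [qs wq] : q \in s /\ 0 < dot w (q - c).
  by move: qr; rewrite mem_filter => /andP[].
pose t := (1 - dot u (q - c)) / dot w (q - c).
have t0 : 0 <= t by rewrite divr_ge0 ?subr_ge0 ?us // ltW.
have uq : dot (u + t *: w) (q - c) = 1.
  by rewrite dotDl dotZl /t divfK ?gt_eqF // addrC subrK.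
have sub p : dot u (p - c) == 1 -> p \in s -> dot (u + t *: w) (p - c) == 1.
  move=> up ps; rewrite dotDl dotZl wt ?mulr0 ?addr0 //.
  by rewrite mem_filter up.
exists (u + t *: w); split.
- move=> p ps; rewrite dotDl dotZl; have [wp|wp] := ltP 0 (dot w (p - c)).
    have : t <= (1 - dot u (p - c)) / dot w (p - c).
      by apply: qmin; rewrite mem_filter wp.
    by rewrite ler_pdivlMr //; lra.
  have : t * dot w (p - c) <= 0 by rewrite mulr_ge0_le0.
  by have := us p ps; lra.
- rewrite dotDl dotZl; have : 0 <= t * dot w (x - c) by rewrite mulr_ge0.
  by lra.
- rewrite /tight; set a := fun p => _; set b := fun p => _.
  have -> : [seq p <- s | a p] = [seq p <- [seq p <- s | b p] | a p].
    rewrite -filter_predI; apply: eq_in_filter => p ps /=.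
    by rewrite /a /b; case: eqP => //= /eqP /sub ->.
  rewrite [X in (X < _)%N]size_filter ltn_neqAle count_size andbT -all_count.
  apply/allPn; exists q; first by rewrite mem_filter /b uq eqxx.
  apply/negP => aq; have := wt q; rewrite mem_filter -/(a q) aq qs => /(_ isT).
  by move=> wq0; rewrite wq0 ltxx in wq.
Qed.

Lemma polar_vertex s c x u : (forall w, w != 0 -> exists2 p, p \in s &
    0 < dot w (p - c)) ->
  polar s c u -> 1 < dot u (x - c) ->
  exists u', [/\ polar s c u', 1 < dot u' (x - c) &
    forall w, (forall p, p \in tight s c u' -> dot w (p - c) = 0) -> w = 0].
Proof.
move=> cs; have [n] := ubnP (size s - size (tight s c u)).
elim: n u => // n IH u un us ux.
have [/(polar_push cs us ux)[u' [us' ux' lt]]|nw] :=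
  pselect (exists2 w, w != 0 &
    forall p, p \in tight s c u -> dot w (p - c) = 0).
  rewrite ltnS in un.
  apply: (IH u') => //; apply: leq_trans un; apply: ltn_sub2l => //.
  apply: leq_trans lt _.
  by rewrite size_filter count_size.
exists u; split=> // w wt; apply/eqP/negPn/negP => wn0.
by apply: nw; exists w.
Qed.

(** Vertices of the polar are facets of the polytope: the tight vertices
    include three points in general position, which are found one after the
    other in the complement of a plane through [c] and the previous ones. *)
Lemma polar_vertex_face_normal s c u : polar s c u ->
  (forall w, (forall p, p \in tight s c u -> dot w (p - c) = 0) -> w = 0) ->
  face_normal (hull s) ((enorm u)^-1 *: u).
Proof.
move=> us ut; set T := tight s c u.
have next X : (size X < 3)%N -> exists w p,
    [/\ forall e, e \in X -> dot w e = 0, p \in T & dot w (p - c) != 0].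
  move=> /exists_orthogonal[w w0 wX]; exists w.
  have [[p pT wp]|np] := pselect (exists2 p, p \in T & dot w (p - c) != 0).
    by exists p.
  move: w0; rewrite (ut w) ?eqxx // => p pT; apply/eqP/negPn/negP => wp.
  by apply: np; exists p.
have [? [p [_ pT _]]] := next [::] isT.
have [w [q [wX qT wq]]] := next [:: p - c] isT.
have [v [r [vX rT vr]]] := next [:: p - c; q - c] isT.
have {}wX : dot w (p - c) = 0 by apply: wX; rewrite inE.
have vp : dot v (p - c) = 0 by apply: vX; rewrite !inE eqxx.
have {vX} vq : dot v (q - c) = 0 by apply: vX; rewrite !inE eqxx orbT.
have uT y : y \in T -> dot u y = 1 + dot u c.
  rewrite mem_filter => /andP[/eqP + _]; rewrite dotBr => uy.
  by rewrite -uy subrK.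
have ind : independent p q r.
  apply/independentP => a b e abe E.
  have E' x : a * dot x (p - c) + b * dot x (q - c) + e * dot x (r - c) = 0.
    have ae : a = - b - e by lra.
    move: (congr1 (dot x) E); rewrite !dotDr !dotZr dot0r !dotNr ae; lra.
  have e0 : e = 0.
    by apply/eqP; have /eqP := E' v; rewrite vp vq !mulr0 !add0r mulf_eq0
      (negPf vr) orbF.
  have b0 : b = 0.
    by apply/eqP; have /eqP := E' w; rewrite wX e0 !mulr0 mul0r add0r addr0
      mulf_eq0 (negPf wq) orbF.
  by split=> //; move: abe; rewrite e0 b0 !addr0.
have u0 : u != 0.
  apply/negP => /eqP u0; have := pT; rewrite mem_filter u0 dotC dot0r.
  by rewrite eq_sym oner_eq0.
have c0 : 0 < (enorm u)^-1 by rewrite invr_gt0 enorm_gt0.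
split; first exact: enorm_normalize.
rewrite (@support_face_hullZ _ _ _ _ (1 + dot u c)) //; last 2 first.
- by move=> y /us; rewrite dotBr lerBlDr.
- by exists p; [move: pT; rewrite mem_filter => /andP[]|exact: uT].
have -> : [seq p <- s | dot u p == 1 + dot u c] = T.
  by apply: eq_filter => y; rewrite dotBr subr_eq.
apply: (has_dim2_plane (u := u) (h := 1 + dot u c) ind) => //;
  try exact: mem_hull.
exact: hull_dot_eq uT.
Qed.

(** The centroid of the vertices is a valid origin for the polar. A plane that
    separates [x] from the polytope gives a point of the polar, and pushing that
    point to a vertex of the polar gives a facet that separates as well. *)
Lemma polytope_halfspaces s x :
  (forall w h, w != 0 -> ~ forall p, p \in s -> dot w p = h) ->
  (forall n h, face_normal (hull s) n -> (forall p, p \in s -> dot n p <= h) ->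
     dot n x <= h) ->
  hull s x.
Proof.
move=> solid facets; apply: contrapT => xs.
have [e e0 _] := @exists_orthogonal [::] isT.
have s0 : s != [::].
  by apply/eqP => s0; apply: (solid e 0 e0) => p; rewrite s0.
have n0 : (size s)%:R != 0 :> R by rewrite pnatr_eq0 size_eq0.
pose c := (size s)%:R^-1 *: \sum_(p <- s) p.
have cs w : w != 0 -> exists2 p, p \in s & 0 < dot w (p - c).
  move=> w0; apply: contrapT => np; apply: (solid w (dot w c) w0) => p ps.
  have le0 q : q \in s -> 0 <= dot w c - dot w q.
    move=> qs; rewrite subr_ge0 leNgt -subr_gt0 -dotBr; apply/negP => wq.
    by apply: np; exists q.
  have : \sum_(q <- s) (dot w c - dot w q) = 0.
    rewrite sumrB big_const_seq count_predT iter_addr_0 -dot_sumr.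
    rewrite -[_ *+ _]mulr_natl -dotZr scalerA mulfV // scale1r subrr //.
  move/eqP; rewrite big_seq psumr_eq0 // => /allP /(_ p ps).
  by rewrite ps subr_eq0 => /eqP.
have [u ux] := hull_separation s0 xs.
have {e e0 s0} [p ps pmax] : exists2 p, p \in s &
    forall q, q \in s -> dot u q <= dot u p.
  have [h [sh [p ps ph]]] := argmax_dot u s0.
  by exists p => // q /sh; rewrite ph.
have u0 : u != 0.
  by apply: contraTneq (ux p ps) => ->; rewrite ![dot 0 _]dotC !dot0r ltxx.
have M : 0 < dot u (p - c).
  have [q qs /lt_le_trans] := cs u u0; apply.
  by rewrite !dotBr lerD2r pmax.
have us : polar s c ((dot u (p - c))^-1 *: u).
  move=> q qs; rewrite dotZl mulrC ler_pdivrMr // mul1r !dotBr lerD2r.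
  exact: pmax.
have ux1 : 1 < dot ((dot u (p - c))^-1 *: u) (x - c).
  by rewrite dotZl mulrC ltr_pdivlMr // mul1r !dotBr ltrD2r; exact: ux.
have [v [vs vx vt]] := polar_vertex cs us ux1.
have fn := polar_vertex_face_normal vs vt.
have v0 : v != 0.
  by apply: contraTneq vx => ->; rewrite dotC dot0r -leNgt ler01.
have V0 : 0 < (enorm v)^-1 by rewrite invr_gt0 enorm_gt0.
have := facets _ ((enorm v)^-1 * (1 + dot v c)) fn.
rewrite dotZl ler_pM2l // => vxle.
have {vxle} : dot v x <= 1 + dot v c.
  by apply: vxle => q /vs; rewrite dotZl ler_pM2l // dotBr lerBlDr.
by apply/negP; rewrite -ltNge; move: vx; rewrite dotBr ltrBrDr.
Qed.

End Facets.

(** * The hip roof *)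

(** The switch [sw] exchanges the two horizontal axes, so that a single
    computation covers both directions of the ridge. *)
Definition point (R : realType) (sw : bool) (x y z : R) : 'rV[R]_3 :=
  if sw then vec3 y x z else vec3 x y z.

Section Coordinates.
Context (R : realType) (sw : bool).
Implicit Types (x y z k : R) (u v w : 'rV[R]_3).

Lemma dot_point x y z x' y' z' :
  dot (point sw x y z) (point sw x' y' z') = x * x' + y * y' + z * z'.
Proof.
rewrite /point /dot; case: sw; rewrite !big_ord_recl big_ord0 !mxE /=; ring.
Qed.

Lemma pointP v : exists x y z, v = point sw x y z.
Proof.
have v3 : v = vec3 (v 0 0) (v 0 1) (v 0 2%:R).
  apply/rowP => i; rewrite mxE; case: i => [[|[|[|//]]] i3] /=;
  by congr (v 0 _); apply: val_inj.
rewrite /point; case: sw; last by exists (v 0 0), (v 0 1), (v 0 2%:R).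
by exists (v 0 1), (v 0 0), (v 0 2%:R).
Qed.

Lemma pointB x y z x' y' z' :
  point sw x y z - point sw x' y' z' = point sw (x - x') (y - y') (z - z').
Proof.
rewrite /point; case: sw; apply/rowP => -[[|[|[|//]]] i3]; by rewrite !mxE.
Qed.

Lemma pointD x y z x' y' z' :
  point sw x y z + point sw x' y' z' = point sw (x + x') (y + y') (z + z').
Proof.
rewrite /point; case: sw; apply/rowP => -[[|[|[|//]]] i3]; by rewrite !mxE.
Qed.

Lemma pointZ k x y z : k *: point sw x y z = point sw (k * x) (k * y) (k * z).
Proof.
rewrite /point; case: sw; apply/rowP => -[[|[|[|//]]] i3]; by rewrite !mxE.
Qed.

Lemma pointN x y z : - point sw x y z = point sw (- x) (- y) (- z).
Proof. by rewrite -sub0r -(subrr (point sw 0 0 0)) !pointB !subrr !sub0r. Qed.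

Lemma enorm_eq v k : 0 <= k -> dot v v = k ^+ 2 -> enorm v = k.
Proof. by move=> k0 vk; rewrite /enorm vk sqrtr_sqr ger0_norm. Qed.

Lemma point_neq0 x y z : 0 < x * x + y * y + z * z -> point sw x y z != 0.
Proof. by move=> ?; rewrite -dotvv_eq0 dot_point gt_eqF. Qed.

Lemma free_dot u v w : u != 0 -> dot w u = 0 -> dot w v != 0 ->
  free [:: u; v].
Proof.
move=> u0 wu wv; apply/free2P => s t E.
have : t * dot w v = 0.
  by have := congr1 (dot w) E; rewrite dotDr !dotZr wu mulr0 add0r dot0r.
move=> /eqP; rewrite mulf_eq0 (negPf wv) orbF => /eqP t0; split=> //.
move: E; rewrite t0 scale0r addr0 => /eqP.
by rewrite scaler_eq0 (negPf u0) orbF => /eqP.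
Qed.

End Coordinates.

(** The base is a rectangle with half-sides [a] and [b], the ridge lies at
    height [b] above it, and all four slopes are of 45 degrees. For [a = b] the two
    ridge points coincide and the roof is a pyramid. *)
Definition roof (R : realType) (sw : bool) (x0 y0 z0 a b : R) :
    seq 'rV[R]_3 :=
  [:: point sw (x0 + a) (y0 + b) z0; point sw (x0 + a) (y0 - b) z0;
      point sw (x0 - a) (y0 - b) z0; point sw (x0 - a) (y0 + b) z0;
      point sw (x0 + a - b) y0 (z0 + b); point sw (x0 - a + b) y0 (z0 + b)].

Section Roof.
Context (R : realType) (sw : bool) (x0 y0 z0 a b : R).

Let P := hull (roof sw x0 y0 z0 a b).
Let pt := @point R sw.

(** A horizontal section is a rectangle whose corners lie on the edges from the
    corners of the base to the ridge. *)
Lemma roof_hull x y z : 0 < b -> b <= a -> z0 <= z ->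
  (x - x0) + (z - z0) <= a -> - (x - x0) + (z - z0) <= a ->
  (y - y0) + (z - z0) <= b -> - (y - y0) + (z - z0) <= b -> P (pt x y z).
Proof.
move=> b0 ba z0z xa xa' yb yb'.
have conv p q v t : P p -> P q -> 0 <= t <= 1 -> v = p + t *: (q - p) -> P v.
  by move=> Pp Pq /andP[t0 t1] ->; apply: hull_convex.
have vertex p : p \in roof sw x0 y0 z0 a b -> P p by move=> ?; apply: mem_hull.
have [rp rm] : P (pt (x0 + a - b) y0 (z0 + b)) /\
               P (pt (x0 - a + b) y0 (z0 + b)).
  by split; apply: vertex; rewrite !inE eqxx ?orbT.
have [zb|bz] := ltP (z - z0) b; last first.
  have yE : y = y0 by lra.
  have zE : z = z0 + b by lra.
  have [ab|ab] := eqVneq a b.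
    have -> : x = x0 + a - b by move: ab xa xa' zE; lra.
    by rewrite yE zE.
  have ab' : b < a by rewrite lt_neqAle eq_sym ab.
  apply: (conv _ _ _ ((x - x0 + (a - b)) / (2 * (a - b))) rm rp).
    apply/andP; split; first by rewrite divr_ge0 //; lra.
    by rewrite ler_pdivrMr; lra.
  rewrite pointB pointZ pointD yE zE; congr point; [field; lra|ring|ring].
have ? : z - z0 < a by lra.
pose t := (z - z0) / b.
have t01 : 0 <= t <= 1.
  by apply/andP; rewrite /t divr_ge0 ?ler_pdivrMr //; lra.
have corner e f : e = 1 \/ e = -1 -> f = 1 \/ f = -1 ->
    P (pt (x0 + e * (a - (z - z0))) (y0 + f * (b - (z - z0))) z).
  move=> eE fE.
  have rE : P (pt (x0 + e * (a - b)) y0 (z0 + b)).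
    case: eE => ->.
      by have -> : x0 + 1 * (a - b) = x0 + a - b by ring.
    by have -> : x0 + -1 * (a - b) = x0 - a + b by ring.
  have cE : P (pt (x0 + e * a) (y0 + f * b) z0).
    by case: eE => ->; case: fE => ->; rewrite ?mul1r ?mulN1r; apply: vertex;
      rewrite !inE eqxx ?orbT.
  apply: (conv _ _ _ t cE rE) => //.
  by rewrite pointB pointZ pointD /t; congr point; field; lra.
have side e : e = 1 \/ e = -1 -> P (pt (x0 + e * (a - (z - z0))) y z).
  move=> eE; apply: (conv _ _ _
    ((y - y0 + (b - (z - z0))) / (2 * (b - (z - z0))))
    (corner e (-1) eE (or_intror erefl)) (corner e 1 eE (or_introl erefl))).
    apply/andP; split; first by rewrite divr_ge0 //; lra.
    by rewrite ler_pdivrMr; lra.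
  by rewrite pointB pointZ pointD; congr point; field; lra.
apply: (conv _ _ _ ((x - x0 + (a - (z - z0))) / (2 * (a - (z - z0))))
  (side (-1) (or_intror erefl)) (side 1 (or_introl erefl))).
  apply/andP; split; first by rewrite divr_ge0 //; lra.
  by rewrite ler_pdivrMr; lra.
by rewrite pointB pointZ pointD; congr point; field; lra.
Qed.

Let s := (Num.sqrt (2 : R))^-1.

Lemma inv_sqrt2_gt0 : 0 < s.
Proof. by rewrite invr_gt0 sqrtr_gt0 ltr0n. Qed.

Local Ltac same_pt := apply/eqP; congr (point _ _ _ _); lra.

Local Ltac mem_pt := rewrite /roof !inE;
  first [exfalso; lra
        | repeat first [same_pt | apply/orP; left; same_pt | apply/orP; right]].

Local Ltac split_all := rewrite /= ?dot_point; do ?(apply/andP; split) => //.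

Lemma roof_base_face : 0 < b -> b <= a ->
  support_face P (pt 0 0 (-1)) =
  hull [:: pt (x0 + a) (y0 + b) z0; pt (x0 + a) (y0 - b) z0;
           pt (x0 - a) (y0 - b) z0; pt (x0 - a) (y0 + b) z0].
Proof.
move=> b0 ba; rewrite -[X in support_face _ X]scale1r.
apply: (@support_face_hull_sub _ _ _ _ _ (- z0)) => //.
- by split_all; lra.
- by split_all; apply/implyP => /eqP E; mem_pt.
- by split_all; first [mem_pt | apply/eqP; ring].
Qed.

Lemma roof_end_face e : 0 < b -> b <= a -> e = 1 \/ e = -1 ->
  support_face P (pt (e * s) 0 s) =
  hull [:: pt (x0 + e * a) (y0 + b) z0; pt (x0 + e * a) (y0 - b) z0;
           pt (x0 + e * (a - b)) y0 (z0 + b)].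
Proof.
move=> b0 ba eE.
have -> : pt (e * s) 0 s = s *: pt e 0 1 by rewrite pointZ mulr0 mulr1 mulrC.
apply: (@support_face_hull_sub _ _ _ _ _ (e * x0 + a + z0)) => //.
- exact: inv_sqrt2_gt0.
- by case: eE => ->; split_all; lra.
- by case: eE => ->; split_all; apply/implyP => /eqP E; mem_pt.
- by case: eE => ->; split_all; first [mem_pt | apply/eqP; ring].
Qed.

Lemma roof_slope_face e : 0 < b -> b <= a -> e = 1 \/ e = -1 ->
  support_face P (pt 0 (e * s) s) =
  hull [:: pt (x0 + a) (y0 + e * b) z0; pt (x0 - a) (y0 + e * b) z0;
           pt (x0 - a + b) y0 (z0 + b); pt (x0 + a - b) y0 (z0 + b)].
Proof.
move=> b0 ba eE.
have -> : pt 0 (e * s) s = s *: pt 0 e 1 by rewrite pointZ mulr0 mulr1 mulrC.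
apply: (@support_face_hull_sub _ _ _ _ _ (e * y0 + b + z0)) => //.
- exact: inv_sqrt2_gt0.
- by case: eE => ->; split_all; lra.
- by case: eE => ->; split_all; apply/implyP => /eqP E; mem_pt.
- by case: eE => ->; split_all; first [mem_pt | apply/eqP; ring].
Qed.

Lemma roof_base_independent : 0 < b -> b <= a ->
  independent (pt (x0 + a) (y0 + b) z0) (pt (x0 + a) (y0 - b) z0)
    (pt (x0 - a) (y0 - b) z0).
Proof.
move=> b0 ba; rewrite /independent !pointB.
apply: (@free_dot _ _ _ (pt 1 0 0)); rewrite ?dot_point.
- by apply: point_neq0; nra.
- by ring.
- by apply/eqP; lra.
Qed.

Lemma roof_end_independent e : 0 < b -> b <= a -> e = 1 \/ e = -1 ->
  independent (pt (x0 + e * a) (y0 + b) z0) (pt (x0 + e * a) (y0 - b) z0)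
    (pt (x0 + e * (a - b)) y0 (z0 + b)).
Proof.
move=> b0 ba eE; rewrite /independent !pointB.
apply: (@free_dot _ _ _ (pt 0 0 1)); rewrite ?dot_point.
- by apply: point_neq0; nra.
- by ring.
- by apply/eqP; lra.
Qed.

Lemma roof_slope_independent e : 0 < b -> b <= a -> e = 1 \/ e = -1 ->
  independent (pt (x0 + a) (y0 + e * b) z0) (pt (x0 - a) (y0 + e * b) z0)
    (pt (x0 - a + b) y0 (z0 + b)).
Proof.
move=> b0 ba eE; rewrite /independent !pointB.
apply: (@free_dot _ _ _ (pt 0 0 1)); rewrite ?dot_point.
- by apply: point_neq0; nra.
- by ring.
- by apply/eqP; lra.
Qed.

Lemma enorm_slanted x y z : 0 <= b -> x ^+ 2 = b ^+ 2 -> y ^+ 2 = b ^+ 2 ->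
  z ^+ 2 = b ^+ 2 -> enorm (pt x y z) = Num.sqrt 3 * b.
Proof.
move=> b0 xb yb zb; apply: enorm_eq; first by rewrite mulr_ge0 ?sqrtr_ge0.
rewrite dot_point exprMn sqr_sqrtr ?ler0n // -!expr2 xb yb zb; ring.
Qed.

Lemma roof_base_perimeter : 0 < b -> b <= a ->
  perimeter (support_face P (pt 0 0 (-1))) = 4 * a + 4 * b.
Proof.
move=> b0 ba; rewrite roof_base_face // quadrangle_perimeter; first last.
- exists 2^-1, 2^-1; split; try by apply/andP; split; lra.
  by rewrite !pointZ !pointD; congr point; field.
- exact: roof_base_independent.
rewrite !pointB (@enorm_eq _ _ (2 * b)); [|lra|rewrite dot_point; ring].
rewrite (@enorm_eq _ _ (2 * a)); [|lra|rewrite dot_point; ring].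
rewrite (@enorm_eq _ _ (2 * b)); [|lra|rewrite dot_point; ring].
rewrite (@enorm_eq _ _ (2 * a)); [|lra|rewrite dot_point; ring].
ring.
Qed.

Lemma roof_end_perimeter e : 0 < b -> b <= a -> e = 1 \/ e = -1 ->
  perimeter (support_face P (pt (e * s) 0 s)) = 2 * b + 2 * (Num.sqrt 3 * b).
Proof.
move=> b0 ba eE; rewrite roof_end_face // triangle_perimeter; last first.
  exact: roof_end_independent.
rewrite !pointB (@enorm_eq _ _ (2 * b)); [|lra|rewrite dot_point; ring].
rewrite !enorm_slanted; first ring; by [exact: ltW|ring|case: eE => ->; ring].
Qed.

(** For a pyramid the slope degenerates to a triangle, and the formula remains
    valid because the ridge has length 0. *)
Lemma roof_slope_perimeter e : 0 < b -> b <= a -> e = 1 \/ e = -1 ->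
  perimeter (support_face P (pt 0 (e * s) s)) =
  2 * a + 2 * (Num.sqrt 3 * b) + 2 * (a - b).
Proof.
move=> b0 ba eE; rewrite roof_slope_face //.
have ind := roof_slope_independent b0 ba eE.
have [ab|ab] := eqVneq a b.
  have -> : pt (x0 + a - b) y0 (z0 + b) = pt (x0 - a + b) y0 (z0 + b).
    by rewrite ab; congr point; ring.
  rewrite (@eq_hull _ _ _ [:: pt (x0 + a) (y0 + e * b) z0;
    pt (x0 - a) (y0 + e * b) z0; pt (x0 - a + b) y0 (z0 + b)]); last first.
    by move=> p; rewrite !inE orbb.
  rewrite triangle_perimeter // !pointB.
  rewrite (@enorm_eq _ _ (2 * a)); [|lra|rewrite dot_point; ring].
  rewrite !enorm_slanted; first (rewrite ab; ring);
    by [exact: ltW|rewrite ?ab; ring|rewrite ?ab; case: eE => ->; ring].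
have {}ab : b < a by rewrite lt_neqAle eq_sym ab.
rewrite quadrangle_perimeter //; last first.
  (* The diagonals of a trapezoid divide each other in the ratio of the parallel
     sides. *)
  pose l := 2 * a / (2 * a + 2 * (a - b)).
  have l01 : 0 < l < 1.
    apply/andP; rewrite /l; split; first by rewrite divr_gt0; lra.
    by rewrite ltr_pdivrMr; lra.
  exists l, l; split=> //.
  rewrite !pointZ !pointD /l; congr point; field; lra.
rewrite !pointB (@enorm_eq _ _ (2 * a)); [|lra|rewrite dot_point; ring].
rewrite enorm_slanted; first last;
  try by [exact: ltW|ring|case: eE => ->; ring].
rewrite (@enorm_eq _ _ (2 * (a - b))); [|lra|rewrite dot_point; ring].
rewrite enorm_slanted; first ring; by [exact: ltW|ring|case: eE => ->; ring].
Qed.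

Lemma inv_sqrt2_sqr : s * s = 2^-1.
Proof. by rewrite -expr2 exprVn sqr_sqrtr ?ler0n. Qed.

Lemma inv_sqrt2_unique k : 0 < k -> k * k + k * k = 1 -> k = s.
Proof.
move=> k0 kk; have s0 := inv_sqrt2_gt0; have ss := inv_sqrt2_sqr.
have : (k - s) * (k + s) = 0 by lra.
by move/eqP; rewrite mulf_eq0 subr_eq0 => /orP[/eqP //|/eqP]; lra.
Qed.

(** Thanks to this criterion the maximum of [u] on the vertices need not be
    computed: in each sign pattern of the coordinates of [u] it is enough to
    exhibit a plane through all the vertices where [u] can be maximal, and that
    plane fixes the direction of [u]. *)
Lemma roof_facet_parallel u w k : has_dim (support_face P u) 2 -> w != 0 ->
  (forall y, y \in roof sw x0 y0 z0 a b ->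
     all (fun z => dot u z <= dot u y) (roof sw x0 y0 z0 a b) -> dot w y = k) ->
  forall v, dot w v = 0 -> dot u v = 0.
Proof.
have [//|h [sh exh]] := @argmax_dot R (roof sw x0 y0 z0 a b) u.
rewrite /P (support_face_hull sh exh) => dim2 w0 wk v wv.
have plane n m : (forall y, y \in roof sw x0 y0 z0 a b -> dot u y = h ->
    dot n y = m) -> forall y,
    hull [seq p <- roof sw x0 y0 z0 a b | dot u p == h] y -> dot n y = m.
  move=> nm; apply: hull_dot_eq => y.
  by rewrite mem_filter => /andP[/eqP yh ys]; apply: nm.
apply: (has_dim2_normal dim2 w0 (plane w k _) (plane u h _) wv) => // y ys yh.
by apply: wk => //; apply/allP => z zs; rewrite yh sh.
Qed.

Lemma roof_face_normal u : 0 < b -> b <= a -> face_normal P u ->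
  u \in [:: pt 0 0 (-1); pt s 0 s; pt (- s) 0 s; pt 0 s s; pt 0 (- s) s].
Proof.
move=> b0 ba [u1 dim2]; have [p [q [r uE]]] := pointP sw u; subst u.
have a0 : 0 < a by exact: lt_le_trans ba.
have pqr : p * p + q * q + r * r = 1.
  rewrite -(dot_point sw); move: u1.
  rewrite /enorm => /(congr1 (fun k => k ^+ 2)).
  by rewrite sqr_sqrtr ?dotvv_ge0 // expr1n.
have par := roof_facet_parallel dim2; rewrite -/pt in par dim2.
have sgn (k : R) : k != 0 -> exists2 e, e = 1 \/ e = -1 & 0 < e * k.
  move=> k0; have [kn|kp|/eqP] := ltgtP k 0; last by rewrite (negPf k0).
    by exists (-1); [right|lra].
  by exists 1; [left|lra].
rewrite !inE.
have [p0|/sgn[e eE ep]] := eqVneq p 0; last first.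
  (* All vertices where [u] is maximal lie on the end slope on the side of the
     sign [e]. *)
  have aep : 0 < a * (e * p) by rewrite mulr_gt0.
  have abp : 0 <= (a - b) * (e * p) by rewrite mulr_ge0 ?subr_ge0 // ltW.
  have pl : forall v, dot (pt e 0 1) v = 0 -> dot (pt p q r) v = 0.
    apply: (par _ (e * x0 + a + z0)); first by apply: point_neq0; nra.
    (* The far ridge point is maximal only for a pyramid, where it coincides
       with the near one. *)
    have flat : (a - b) * (e * p) <= 0 -> a = b.
      move=> ab; have : (a - b) * (e * p) = 0 by lra.
      by move=> /eqP; rewrite mulf_eq0 (gt_eqF ep) orbF => /eqP; lra.
    move=> y; rewrite !inE => /or4P[| | |/or3P[| |]] /eqP ->;
      rewrite /= !dot_point => /and5P[i1 i2 i3 i4 /and3P[i5 i6 _]];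
      case: eE ep aep abp flat => -> ep aep abp flat; try lra;
      by rewrite flat; lra.
  have := pl (pt 0 1 0); have := pl (pt 1 0 (- e)).
  rewrite !dot_point => pr q0.
  have {q0} q0 : q = 0 by lra.
  case: eE ep pr {aep abp pl} => -> ep pr.
    have {pr} pr : r = p by lra.
    have ps : p = s by apply: inv_sqrt2_unique; [lra|rewrite -pqr q0 pr; ring].
    by rewrite pr ps q0 eqxx !orbT.
  have {pr} pr : r = - p by lra.
  have ps : - p = s by apply: inv_sqrt2_unique; [lra|rewrite -pqr q0 pr; ring].
  by rewrite pr ps q0 -ps opprK eqxx !orbT.
have [q0|/sgn[e eE eq]] := eqVneq q 0; last first.
  (* All vertices where [u] is maximal lie on the long slope on the side of
     the sign [e]. *)
  have beq : 0 < b * (e * q) by rewrite mulr_gt0.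
  have pl : forall v, dot (pt 0 e 1) v = 0 -> dot (pt p q r) v = 0.
    apply: (par _ (e * y0 + b + z0)); first by apply: point_neq0; nra.
    move=> y; rewrite !inE => /or4P[| | |/or3P[| |]] /eqP ->;
      rewrite /= !dot_point => /and5P[i1 i2 i3 i4 /and3P[i5 i6 _]];
      case: eE eq beq => -> eq beq; lra.
  have := pl (pt 0 1 (- e)); rewrite !dot_point => qr.
  case: eE eq qr {beq pl} => -> eq qr.
    have {qr} qr : r = q by lra.
    have qs : q = s by apply: inv_sqrt2_unique; [lra|rewrite -pqr p0 qr; ring].
    by rewrite qr qs p0 eqxx !orbT.
  have {qr} qr : r = - q by lra.
  have qs : - q = s by apply: inv_sqrt2_unique; [lra|rewrite -pqr p0 qr; ring].
  by rewrite qr qs p0 -qs opprK eqxx !orbT.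
have [r0|r0] := ltP r 0.
  have : (r + 1) * (r - 1) = 0 by move: pqr; rewrite p0 q0; lra.
  move=> /eqP; rewrite mulf_eq0 => /orP[]/eqP rr; last by lra.
  by have -> : r = -1 by [lra]; rewrite p0 q0 eqxx.
have {}r0 : 0 < r.
  rewrite lt_neqAle r0 andbT; apply/eqP => r0'.
  by move: pqr; rewrite p0 q0 -r0'; lra.
(* A vertical normal pointing upwards is maximal on the ridge only, and the ridge
   lies in a vertical plane. *)
have rb : 0 < b * r by rewrite mulr_gt0.
have := par (pt 0 1 0) y0 _ _ (pt 0 0 1); rewrite !dot_point => h.
suff: r = 0 by lra.
apply: etrans (h _ _ _); [by rewrite p0 q0; ring| | |by ring].
  by apply: point_neq0; lra.
move=> y; rewrite !inE => /or4P[| | |/or3P[| |]] /eqP ->;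
  rewrite /= !dot_point p0 q0 => /and5P[i1 i2 i3 i4 /and3P[i5 i6 _]]; lra.
Qed.

Lemma roof_face_normalP u : 0 < b -> b <= a -> face_normal P u <->
  u \in [:: pt 0 0 (-1); pt s 0 s; pt (- s) 0 s; pt 0 s s; pt 0 (- s) s].
Proof.
move=> b0 ba; split=> [|uE]; first exact: roof_face_normal.
have ss := inv_sqrt2_sqr; have s0 := inv_sqrt2_gt0.
have u1 : enorm u = 1.
  apply: enorm_eq => //; move: uE; rewrite !inE.
  by move=> /or4P[| | |/orP[]] /eqP ->; rewrite dot_point; lra.
have u0 := enorm1_neq0 u1; split=> //.
have dim2 p q r t : support_face P u = hull (p :: q :: r :: t) ->
    independent p q r -> has_dim (support_face P u) 2.
  move=> E ind; apply: (has_dim2_plane ind _ _ _ u0) => [|||y [_]].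
  - by rewrite E; apply: mem_hull; rewrite !inE eqxx.
  - by rewrite E; apply: mem_hull; rewrite !inE eqxx orbT.
  - by rewrite E; apply: mem_hull; rewrite !inE eqxx !orbT.
  - by apply.
have o : (1 : R) = 1 \/ (1 : R) = -1 by left.
have o' : (-1 : R) = 1 \/ (-1 : R) = -1 by right.
move: uE; rewrite !inE => /or4P[| | |/orP[]] /eqP uE; rewrite uE in dim2 *.
- exact: dim2 (roof_base_face b0 ba) (roof_base_independent b0 ba).
- have := roof_end_face b0 ba o; rewrite mul1r => /dim2; apply.
  exact: roof_end_independent.
- have := roof_end_face b0 ba o'; rewrite mulN1r => /dim2; apply.
  exact: roof_end_independent.
- have := roof_slope_face b0 ba o; rewrite mul1r => /dim2; apply.
  exact: roof_slope_independent.
- have := roof_slope_face b0 ba o'; rewrite mulN1r => /dim2; apply.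
  exact: roof_slope_independent.
Qed.

End Roof.

(** * The identity principle along a line *)

Section IdentityPrinciple.
Context (R : realType).

(** Several terms may have the same degree: a polynomial in several variables,
    restricted to a line, has this form with one term for each monomial, and its
    terms need not be collected. *)
Definition terms_sum (I : finType) (a : I -> R) (deg : I -> nat) (t : R) : R :=
  \sum_i a i * t ^+ deg i.

Lemma tail_bound (I : finType) (a : I -> R) (deg : I -> nat) (r M t : R) n :
  0 < r -> `|t| <= r -> \sum_i `|a i| * r ^+ deg i <= M ->
  `|\sum_(i | (n <= deg i)%N) a i * t ^+ deg i| <= M * (`|t| / r) ^+ n.
Proof.
move=> r0 tr aM.
have q0 : 0 <= `|t| / r by rewrite divr_ge0 // ltW.
have q1 : `|t| / r <= 1 by rewrite ler_pdivrMr // mul1r.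
apply: le_trans (ler_norm_sum _ _ _) _.
apply: (@le_trans _ _ ((\sum_i `|a i| * r ^+ deg i) * (`|t| / r) ^+ n));
  last by rewrite ler_wpM2r // exprn_ge0.
rewrite mulr_suml [leRHS](bigID (fun i => n <= deg i)%N) /=.
rewrite ler_wpDr //.
  apply: sumr_ge0 => i _.
  by rewrite !mulr_ge0 // ?exprn_ge0 // ltW.
apply: ler_sum => i ni; rewrite normrM -mulrA ler_wpM2l // normrX.
have -> : `|t| ^+ deg i = r ^+ deg i * (`|t| / r) ^+ deg i.
  by rewrite -exprMn mulrC divfK // gt_eqF.
by rewrite ler_wpM2l ?ler_wiXn2l // exprn_ge0 // ltW.
Qed.

Unset Implicit Arguments.
Variables (I : nat -> finType) (a : forall N, I N -> R).
Variables (deg : forall N, I N -> nat) (r M e : R).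
Set Implicit Arguments.
Hypotheses (r0 : 0 < r) (e0 : 0 < e).
Hypothesis aM : forall N, \sum_i `|a N i| * r ^+ deg N i <= M.
Hypothesis small : forall t, 0 < t < e ->
  (fun N => terms_sum (a N) (deg N) t) @ \oo --> (0 : R).

Let low n N t := \sum_(i | (deg N i < n)%N) a N i * t ^+ deg N i.
Let coef n N := \sum_(i | deg N i == n) a N i.

Let M0 : 0 <= M.
Proof.
apply: le_trans (aM 0); apply: sumr_ge0 => i _.
by rewrite mulr_ge0 // exprn_ge0 // ltW.
Qed.

Let lowS n N t : low n.+1 N t = low n N t + coef n N * t ^+ n.
Proof.
rewrite /low (bigID (fun i => deg N i == n)) /= addrC; congr (_ + _).
  by apply: eq_bigl => i; rewrite ltnS andbC -ltn_neqAle.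
rewrite /coef mulr_suml; apply: eq_big => [i|i /andP[_ /eqP -> //]].
by rewrite andb_idl // => /eqP ->.
Qed.

Let split_low n N t : terms_sum (a N) (deg N) t =
  low n N t + \sum_(i | (n <= deg N i)%N) a N i * t ^+ deg N i.
Proof.
rewrite /terms_sum (bigID (fun i => deg N i < n)%N) /=; congr (_ + _).
by apply: eq_bigl => i; rewrite -leqNgt.
Qed.

(** Induction on the degree. At a small [x > 0] the whole sum and its part of
    degree less than [n] tend to 0, while the part of degree more than [n] is of
    order [x ^+ n.+1] uniformly in [N]; after division by [x ^+ n] the limit
    superior of [`|coef n N|] is at most of order [x]. *)
Let low_cvg0 n t : (fun N => low n N t) @ \oo --> (0 : R).
Proof.
elim: n t => [|n IH] t.
  rewrite (_ : (fun N => _) = fun=> 0); first exact: cvg_cst.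
  by apply/funext => N; rewrite /low big_pred0.
suff coef0 : coef n @ \oo --> (0 : R).
  rewrite (_ : (fun N => _) = fun N => low n N t + coef n N * t ^+ n).
    rewrite -[X in _ --> X]addr0 -[X in _ --> _ + X](mul0r (t ^+ n)).
    by apply: cvgD; [exact: IH|apply: cvgM; [exact: coef0|exact: cvg_cst]].
  by apply/funext => N; exact: lowS.
apply/cvgr0Pnorm_lt => d d0.
(* The part of degree more than [n] at [x] is at most [k * x * x ^+ n]. *)
pose k := M / r ^+ n.+1.
have k0 : 0 <= k by rewrite divr_ge0 // exprn_ge0 // ltW.
pose x := Num.min (e / 2) (Num.min r (d / (2 * (k + 1)))).
have x0 : 0 < x.
  by rewrite !lt_min r0 !divr_gt0 ?mulr_gt0 ?ltr_wpDl ?ltr0n.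
have xe : x < e.
  by rewrite gt_min ltr_pdivrMr ?ltr0n // ltr_pMr // ltr1n.
have xr : x <= r by rewrite !ge_min lexx orbT.
have kx : k * x < d / 2.
  have : x <= d / (2 * (k + 1)) by rewrite !ge_min lexx !orbT.
  rewrite ler_pdivlMr; lra.
have xn : 0 < x ^+ n by rewrite exprn_gt0.
have tail N : `|\sum_(i | (n.+1 <= deg N i)%N) a N i * x ^+ deg N i| <=
    k * x * x ^+ n.
  have := @tail_bound _ (a N) (deg N) r M x n.+1 r0 _ (aM N).
  rewrite gtr0_norm // => /(_ xr) /le_trans; apply.
  by rewrite exprMn exprVn /k [x ^+ n.+1]exprS; lra.
have dx : 0 < d / 4 * x ^+ n by rewrite mulr_gt0 // divr_gt0 ?ltr0n.
have sx : (fun N => terms_sum (a N) (deg N) x) @ \oo --> (0 : R).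
  by apply: small; rewrite x0.
near=> N.
rewrite -(ltr_pM2r xn) -(gtr0_norm xn) -normrM (gtr0_norm xn).
have -> : coef n N * x ^+ n = terms_sum (a N) (deg N) x - low n N x -
    \sum_(i | (n.+1 <= deg N i)%N) a N i * x ^+ deg N i.
  by rewrite (split_low n.+1) lowS; ring.
apply: le_lt_trans (ler_normB _ _) _.
have h1 : `|terms_sum (a N) (deg N) x| < d / 4 * x ^+ n.
  by near: N; apply: cvgr0_norm_lt dx.
have h2 : `|low n N x| < d / 4 * x ^+ n.
  by near: N; apply: cvgr0_norm_lt dx; exact: IH.
have h3 := tail N; have h4 := ler_normB (terms_sum (a N) (deg N) x) (low n N x).
have : k * x * x ^+ n < d / 2 * x ^+ n by rewrite ltr_pM2r.
lra.
Unshelve. all: by end_near. Qed.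

(** The uniform bound at [r] makes the terms of high degree negligible on every
    smaller disc, uniformly in [N], and those of low degree tend to 0. *)
Lemma terms_sum_cvg0 t : `|t| < r ->
  (fun N => terms_sum (a N) (deg N) t) @ \oo --> (0 : R).
Proof.
move=> tr; apply/cvgr0Pnorm_lt => d d0.
have q0 : 0 <= `|t| / r by rewrite divr_ge0 // ltW.
have q1 : `|(`|t| / r)| < 1 by rewrite ger0_norm // ltr_pdivrMr // mul1r.
have : (fun n => M * (`|t| / r) ^+ n) @ \oo --> (0 : R).
  rewrite -[X in _ --> X](mulr0 M).
  by apply: cvgM; [exact: cvg_cst|exact: cvg_expr].
have d2 : 0 < d / 2 by lra.
move=> /cvgr0_norm_lt/(_ _ d2)[n _ /(_ n (leqnn n)) Mn].
near=> N.
rewrite (split_low n); apply: le_lt_trans (ler_normD _ _) _.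
have h1 : `|low n N t| < d / 2.
  by near: N; apply: cvgr0_norm_lt d2; exact: low_cvg0.
have h2 := tail_bound n r0 (ltW tr) (aM N).
have h3 := le_lt_trans (ler_norm _) Mn.
by have := le_lt_trans h2 h3; lra.
Unshelve. all: by end_near. Qed.

End IdentityPrinciple.

Lemma box_sum_le (R : realType) (d : nat) (f : {ffun 'I_d -> nat} -> R) :
  summable [set: {ffun 'I_d -> nat}] (fun al => (f al)%:E) ->
  exists M, forall N,
    \sum_(b : {ffun 'I_d -> 'I_N}) `|f [ffun i => b i : nat]| <= M.
Proof.
move=> sf; pose S := \esum_(x in [set: {ffun 'I_d -> nat}]) `|(f x)%:E|%E.
exists (fine S) => N; rewrite -lee_fin fineK; last by rewrite -summableE.
apply: esum_ge.
pose inj (b : {ffun 'I_d -> 'I_N}) : {ffun 'I_d -> nat} :=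
  [ffun i => b i : nat].
pose s := map inj (index_enum {ffun 'I_d -> 'I_N}).
exists [set` s]; first by split; [exact: finite_seq|exact: subsetT].
rewrite -fsbig_seq; last first.
  rewrite map_inj_uniq ?index_enum_uniq // => b b' /ffunP bb'.
  by apply/ffunP => i; have := bb' i; rewrite !ffunE => /val_inj.
by rewrite big_map -sumEFin; apply: lee_sum => b _.
Qed.

(** Restricted to a line, an analytic function is near [t = 0] a limit of
    polynomials in [t], namely of the partial sums of the power series over boxes
    of multi-indices. Absolute convergence at one parameter gives the bound that
    [terms_sum_cvg0] requires, so the double series is never rearranged. *)
Lemma real_analytic_line_eq0 (R : realType) (d : nat) (phi : 'rV[R]_d -> R)
    (x v : 'rV[R]_d) : real_analytic phi ->
  (\forall t \near (0 : R), 0 < t -> phi (x + t *: v) = 0) ->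
  \forall t \near (0 : R), phi (x + t *: v) = 0.
Proof.
move=> /(_ x)[c near_c] near_0.
have near_ct : \forall t \near (0 : R),
    power_series_sum c (t *: v) (phi (x + t *: v)).
  have line : x + t *: v @[t --> (0 : R)] --> x + 0 *: v.
    apply: cvgD; first exact: cvg_cst.
    by apply: cvgZ; [exact: cvg_id|exact: cvg_cst].
  rewrite scale0r addr0 in line.
  near=> t; have : power_series_sum c (x + t *: v - x) (phi (x + t *: v)).
    by near: t; exact: line _ near_c.
  by rewrite addrC addKr.
have {near_0} /nbhs_ballP[e /= e0 eP] := near_0.
have {near_ct} /nbhs_ballP[r' /= r'0 rP] := near_ct.
pose r := r' / 2; have r0 : 0 < r by rewrite divr_gt0.
have term al t : monomial_term c (t *: v) al =
    monomial_term c v al * t ^+ (\sum_i al i)%N.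
  rewrite /monomial_term -mulrA; congr (_ * _).
  rewrite expr_sum -big_split; apply: eq_bigr => i _ /=.
  by rewrite mxE exprMn mulrC.
have [M boxM] : exists M, forall N,
    \sum_(b : {ffun 'I_d -> 'I_N})
      `|monomial_term c (r *: v) [ffun i => b i : nat]| <= M.
  apply: box_sum_le.
  have : ball (0 : R) r' r.
    by rewrite /ball /= sub0r normrN gtr0_norm // /r; lra.
  by move=> /rP[].
pose a N (b : {ffun 'I_d -> 'I_N}) := monomial_term c v [ffun i => b i : nat].
pose deg N (b : {ffun 'I_d -> 'I_N}) := (\sum_i b i)%N.
have sumE t : (fun N => \sum_(b : {ffun 'I_d -> 'I_N})
    monomial_term c (t *: v) [ffun i => b i : nat]) =
    (fun N => terms_sum (@a N) (@deg N) t).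
  apply/funext => N; apply: eq_bigr => b _; rewrite term; congr (_ * _ ^+ _).
  by apply: eq_bigr => i _; rewrite ffunE.
have aM N : \sum_i `|a N i| * r ^+ deg N i <= M.
  apply: le_trans (boxM N); apply: ler_sum => b _; rewrite term [leRHS]normrM.
  have -> : (\sum_i [ffun j => b j : nat] i)%N = deg N b.
    by apply: eq_bigr => i _; rewrite ffunE.
  by rewrite [X in _ <= _ * X]ger0_norm // exprn_ge0 // ltW.
have cvg t : `|t| < r' ->
    (fun N => terms_sum (@a N) (@deg N) t) @ \oo --> phi (x + t *: v).
  move=> tr; rewrite -sumE; have : ball (0 : R) r' t.
    by rewrite /ball /= sub0r normrN.
  by move=> /rP[].
apply/nbhs_ballP; exists r => //= t; rewrite /ball /= sub0r normrN => tr.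
have tr' : `|t| < r' by apply: lt_trans tr _; rewrite /r; lra.
apply: (cvg_unique (@Rhausdorff R) (cvg t tr')).
apply: (@terms_sum_cvg0 _ _ (@a) (@deg) r M (Num.min e r')) => //.
  by rewrite lt_min e0.
move=> u /andP[u0]; rewrite lt_min => /andP[ue ur].
rewrite -(eP u _ u0); last by rewrite /ball /= sub0r normrN gtr0_norm.
by apply: cvg; rewrite gtr0_norm.
Unshelve. all: by end_near.
Qed.

(** * The perimeters of polytopes with the given normals *)

Section Classification.
Context (R : realType).
Implicit Types (s : seq 'rV[R]_3) (n w : 'rV[R]_3) (h k a b x y z : R).

Let r := (Num.sqrt (2 : R))^-1.

Definition roof_normals (sw : bool) : seq 'rV[R]_3 :=
  [:: point sw 0 0 (-1); point sw r 0 r; point sw (- r) 0 r;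
      point sw 0 r r; point sw 0 (- r) r].

Lemma range_normals sw : range (@normals R) = [set` roof_normals sw].
Proof.
apply/seteqP; split=> [_ [k _ <-]|u] /=.
  case: k => [[|[|[|[|[|//]]]]] k5]; rewrite /normals /= !inE /point;
  case: sw; by rewrite eqxx ?orbT.
have ex (i : nat) (i5 : (i < 5)%N) :
  range (@normals R) (normals R (Ordinal i5)) by exists (Ordinal i5).
rewrite !inE /point => /or4P[| | |/orP[]] /eqP ->; case: sw;
  first [exact: (ex 0%N isT) | exact: (ex 1%N isT) | exact: (ex 2%N isT)
        | exact: (ex 3%N isT) | exact: (ex 4%N isT)].
Qed.

Definition is_height s n h :=
  (forall p, p \in s -> dot n p <= h) /\ exists2 p, p \in s & dot n p = h.

(** A plane through all vertices would be parallel both to the base and to a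
    slope. *)
Lemma roof_normals_solid sw s :
  [set u | face_normal (hull s) u] = [set` roof_normals sw] ->
  forall w h, w != 0 -> ~ forall p, p \in s -> dot w p = h.
Proof.
move=> fn w h w0 wh.
have wn n : n \in roof_normals sw -> forall v, dot n v = 0 -> dot w v = 0.
  move=> nE; have : [set` roof_normals sw] n by [].
  rewrite -fn => -[/enorm1_neq0 n0 dim2].
  apply: (has_dim2_normal dim2 n0) => [p [_]|p [ps _]]; first by apply.
  exact: hull_dot_eq wh p ps.
have [x [y [z wE]]] := pointP sw w.
have base : point sw 0 0 (-1) \in roof_normals sw by rewrite inE eqxx.
have slope : point sw r 0 r \in roof_normals sw by rewrite !inE eqxx orbT.
have x0 : x = 0.
  have : dot w (point sw 1 0 0) = 0.
    by apply: wn base _ _; rewrite dot_point; ring.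
  by rewrite wE dot_point; lra.
have y0 : y = 0.
  have : dot w (point sw 0 1 0) = 0.
    by apply: wn base _ _; rewrite dot_point; ring.
  by rewrite wE dot_point; lra.
have z0 : z = 0.
  have : dot w (point sw (-1) 0 1) = 0.
    by apply: wn slope _ _; rewrite dot_point; ring.
  by rewrite wE dot_point x0; lra.
by move: w0; rewrite wE -dotvv_eq0 dot_point x0 y0 z0 !mulr0 !addr0 eqxx.
Qed.

(** The roof is the solution set of the five facet inequalities, and so is the
    polytope by [polytope_halfspaces]. *)
Lemma hull_roof sw s x0 y0 z0 a b : 0 < b -> b <= a ->
  [set u | face_normal (hull s) u] = [set` roof_normals sw] ->
  is_height s (point sw 0 0 (-1)) (- z0) ->
  is_height s (point sw 1 0 1) (x0 + a + z0) ->
  is_height s (point sw (-1) 0 1) (- x0 + a + z0) ->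
  is_height s (point sw 0 1 1) (y0 + b + z0) ->
  is_height s (point sw 0 (-1) 1) (- y0 + b + z0) ->
  hull s = hull (roof sw x0 y0 z0 a b).
Proof.
move=> b0 ba fn H1 H2 H3 H4 H5; apply/seteqP; split.
  apply: (hull_min (@hull_convex _ _ _)) => p ps.
  have [x [y [z pE]]] := pointP sw p; subst p.
  have := H1.1 _ ps; have := H2.1 _ ps; have := H3.1 _ ps; have := H4.1 _ ps.
  have := H5.1 _ ps; rewrite !dot_point => ? ? ? ? ?.
  by apply: roof_hull => //; lra.
apply: (hull_min (@hull_convex _ _ _)) => v vs.
apply: polytope_halfspaces (roof_normals_solid fn) _ => n h nf nh.
have {nf} : [set` roof_normals sw] n by rewrite -fn.
have r0 : 0 < r := inv_sqrt2_gt0 R.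
have bound m l c : 0 < c -> is_height s m l -> dot m v <= l -> n = c *: m ->
    dot n v <= h.
  move=> c0 [_ [p ps pl]] vl nE; apply: le_trans (nh p ps).
  by rewrite nE !dotZl pl ler_pM2l.
have vle m l : all (fun p => dot m p <= l) (roof sw x0 y0 z0 a b) ->
    dot m v <= l by move=> /allP; apply.
rewrite /= !inE => /or4P[| | |/orP[]] /eqP nE.
- apply: (bound _ _ 1 ltr01 H1); last by rewrite scale1r.
  by apply: vle; rewrite /= !dot_point; do !(apply/andP; split) => //; lra.
- apply: (bound _ _ r r0 H2); last by rewrite pointZ mulr0 mulr1.
  by apply: vle; rewrite /= !dot_point; do !(apply/andP; split) => //; lra.
- apply: (bound _ _ r r0 H3); last by rewrite pointZ mulr0 mulr1 mulrN1.
  by apply: vle; rewrite /= !dot_point; do !(apply/andP; split) => //; lra.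
- apply: (bound _ _ r r0 H4); last by rewrite pointZ mulr0 mulr1.
  by apply: vle; rewrite /= !dot_point; do !(apply/andP; split) => //; lra.
- apply: (bound _ _ r r0 H5); last by rewrite pointZ mulr0 mulr1 mulrN1.
  by apply: vle; rewrite /= !dot_point; do !(apply/andP; split) => //; lra.
Qed.

(** The distance from the axis of symmetry to a pair of opposite slopes at the
    level of the base is positive, for otherwise the base would be flat. *)
Lemma half_side_gt0 s (m : 'rV[R]_3) x0 z0 a :
  dot m (point false 0 0 1) = 0 -> m != 0 ->
  has_dim (support_face (hull s) (point false 0 0 (-1))) 2 ->
  is_height s (point false 0 0 (-1)) (- z0) ->
  is_height s (m + point false 0 0 1) (x0 + a + z0) ->
  is_height s (- m + point false 0 0 1) (- x0 + a + z0) -> 0 < a.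
Proof.
move=> m3 m0 dim2 [H1 E1] [H2 _] [H3 _]; rewrite ltNge; apply/negP => a0.
have n0 : point false 0 0 (-1) != 0 :> 'rV[R]_3 by apply: point_neq0; lra.
have down : point false 0 0 (-1) = - point false 0 0 1 :> 'rV[R]_3.
  by rewrite pointN !oppr0.
have base p : support_face (hull s) (point false 0 0 (-1)) p ->
    dot (point false 0 0 (-1)) p = - z0.
  by move=> [_]; rewrite /support_plane (sup_hull H1 E1).
have axis p : support_face (hull s) (point false 0 0 (-1)) p -> dot m p = x0.
  move=> pF; have := base p pF.
  have := hull_le H2 pF.1; have := hull_le H3 pF.1.
  by rewrite down !dotDl !dotNl; lra.
move: m0; rewrite -dotvv_eq0 (has_dim2_normal dim2 n0 base axis) ?eqxx //.
by rewrite down dotNl dotC m3 oppr0.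
Qed.

(** The levels of two opposite slopes determine their plane of symmetry and, with
    the level of the base, the half-side of the rectangle between them. The
    switch is set when the half-side along the second axis is the longer one. *)
Lemma polytope_roof (P : set 'rV[R]_3) : is_polytope P ->
  [set u | face_normal P u] = range (@normals R) ->
  exists sw x0 y0 z0 a b, [/\ 0 < b, b <= a & P = hull (roof sw x0 y0 z0 a b)].
Proof.
move=> /is_polytopeP[s ->]; rewrite (range_normals false) => fn.
have dim2 : has_dim (support_face (hull s) (point false 0 0 (-1))) 2.
  have : [set` roof_normals false] (point false 0 0 (-1)).
    by rewrite /= inE eqxx.
  by rewrite -fn => -[].
have s0 : s != [::].
  have [p [+ _]] := has_dim_nonempty dim2.
  by apply: contraPneq => ->; rewrite hull_nil.
have heights n : exists h, is_height s n h by exact: argmax_dot.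
have [h1 H1] := heights (point false 0 0 (-1)).
have [h2 H2] := heights (point false 1 0 1).
have [h3 H3] := heights (point false (-1) 0 1).
have [h4 H4] := heights (point false 0 1 1).
have [h5 H5] := heights (point false 0 (-1) 1).
pose z0 := - h1; pose x0 := (h2 - h3) / 2; pose a := (h2 + h3) / 2 - z0.
pose y0 := (h4 - h5) / 2; pose b := (h4 + h5) / 2 - z0.
have {}H1 : is_height s (point false 0 0 (-1)) (- z0) by rewrite /z0 opprK.
have {}H2 : is_height s (point false 1 0 1) (x0 + a + z0).
  by have -> : x0 + a + z0 = h2 by rewrite /x0 /a; field.
have {}H3 : is_height s (point false (-1) 0 1) (- x0 + a + z0).
  by have -> : - x0 + a + z0 = h3 by rewrite /x0 /a; field.
have {}H4 : is_height s (point false 0 1 1) (y0 + b + z0).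
  by have -> : y0 + b + z0 = h4 by rewrite /y0 /b; field.
have {}H5 : is_height s (point false 0 (-1) 1) (- y0 + b + z0).
  by have -> : - y0 + b + z0 = h5 by rewrite /y0 /b; field.
have a0 : 0 < a.
  apply: (@half_side_gt0 s (point false 1 0 0) x0 z0) => //.
  - by rewrite dot_point; ring.
  - by apply: point_neq0; lra.
  - by rewrite pointD !addr0 add0r.
  - by rewrite pointN pointD !oppr0 !addr0 add0r.
have b0 : 0 < b.
  apply: (@half_side_gt0 s (point false 0 1 0) y0 z0) => //.
  - by rewrite dot_point; ring.
  - by apply: point_neq0; lra.
  - by rewrite pointD !addr0 add0r.
  - by rewrite pointN pointD !oppr0 !addr0 add0r.
have [ba|ab] := leP b a.
  by exists false, x0, y0, z0, a, b; split=> //; exact: hull_roof.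
exists true, y0, x0, z0, b, a; split; [by []|exact: ltW|].
apply: hull_roof; rewrite ?(ltW ab) //.
by rewrite fn -(range_normals false) (range_normals true).
Qed.

End Classification.

Section Perimeters.
Context (R : realType).
Implicit Types (L : 'rV[R]_5) (a b : R).

Let i1 : 'I_5 := @Ordinal 5 1 isT.
Let i3 : 'I_5 := @Ordinal 5 3 isT.

Definition roof_perimeters a b : 'rV[R]_5 :=
  let e := 2 * b + 2 * (Num.sqrt 3 * b) in
  let f := 2 * a + 2 * (Num.sqrt 3 * b) + 2 * (a - b) in
  \row_i [:: 4 * a + 4 * b; e; e; f; f]`_i.

Lemma roof_perimetersP a b : 0 < b -> b <= a ->
  perimeter_set (@normals R) (roof_perimeters a b).
Proof.
move=> b0 ba; exists (hull (roof false 0 0 0 a b)); split.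
- by apply/is_polytopeP; exists (roof false 0 0 0 a b).
- by rewrite (range_normals _ false); apply/seteqP; split=> u /=;
    rewrite roof_face_normalP.
have o : (1 : R) = 1 \/ (1 : R) = -1 by left.
have o' : (-1 : R) = 1 \/ (-1 : R) = -1 by right.
move=> [[|[|[|[|[|//]]]]] k5]; rewrite mxE /=.
- by rewrite -(roof_base_perimeter false 0 0 0 b0 ba).
- by rewrite -(roof_end_perimeter false 0 0 0 b0 ba o) mul1r.
- by rewrite -(roof_end_perimeter false 0 0 0 b0 ba o') mulN1r.
- by rewrite -(roof_slope_perimeter false 0 0 0 b0 ba o) mul1r.
- by rewrite -(roof_slope_perimeter false 0 0 0 b0 ba o') mulN1r.
Qed.

(** The two alternatives correspond to the two directions of the ridge. *)
Lemma perimeter_setP L : perimeter_set (@normals R) L ->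
  exists a b, [/\ 0 < b, b <= a, L 0 0 = 4 * a + 4 * b &
    let e := 2 * b + 2 * (Num.sqrt 3 * b) in
    let f := 2 * a + 2 * (Num.sqrt 3 * b) + 2 * (a - b) in
    L 0 i1 = e /\ L 0 i3 = f \/ L 0 i1 = f /\ L 0 i3 = e].
Proof.
move=> [P [polyP fn LE]].
have [sw [x0 [y0 [z0 [a [b [b0 ba PE]]]]]]] := polytope_roof polyP fn.
exists a, b; split=> //.
  rewrite LE -(roof_base_perimeter sw x0 y0 z0 b0 ba) PE.
  by case: (sw).
have o : (1 : R) = 1 \/ (1 : R) = -1 by left.
move=> e f; have := roof_slope_perimeter sw x0 y0 z0 b0 ba o.
have := roof_end_perimeter sw x0 y0 z0 b0 ba o.
rewrite mul1r -PE -/e -/f => <- <-; rewrite !LE.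
by case: sw {PE}; [right|left].
Qed.

End Perimeters.

(** * Failure of local analyticity at the pyramid *)

Theorem theorem5 (R : realType) :
  ~ locally_analytic (perimeter_set (@normals R)).
Proof.
move=> la.
pose L t : 'rV[R]_5 :=
  roof_perimeters 1 1 + t *: (roof_perimeters 2 1 - roof_perimeters 1 1).
have LE t : L t = roof_perimeters (1 + t) 1.
  by apply/rowP => -[[|[|[|[|[|//]]]]] k5]; rewrite !mxE /=; ring.
have Lin t : 0 <= t -> perimeter_set (@normals R) (L t).
  by move=> t0; rewrite LE; apply: roof_perimetersP; lra.
have Lout t : t < 0 -> ~ perimeter_set (@normals R) (L t).
  move=> t0 /perimeter_setP[a [b [b0 ba]]]; rewrite LE !mxE /=.
  have q0 : 0 <= Num.sqrt (3 : R) := sqrtr_ge0 _.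
  have qq : Num.sqrt 3 * Num.sqrt 3 = 3 :> R by rewrite -expr2 sqr_sqrtr ?ler0n.
  move: (Num.sqrt 3) q0 qq => q q0 qq.
  move=> h0 [] [h1 h3].
    (* Ridge along the first axis: [b = 1] and [a = 1 + t] contradict
       [b <= a]. *)
    have : (b - 1) * (1 + q) = 0 by lra.
    by move=> /eqP; rewrite mulf_eq0 => /orP[]/eqP; lra.
  (* Ridge along the second axis: the three equations imply [b = 1], and then
     [t = 0]. *)
  have : (q - 1) * (b - 1) = 0 by lra.
  move=> /eqP; rewrite mulf_eq0 => /orP[]/eqP; last by lra.
  by move=> /eqP; rewrite subr_eq0 => /eqP q1; move: qq; rewrite q1; lra.
have [|U [B0 [nU [phi phi_an B0E] BU]]] := la (L 0); first exact: Lin.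
have LU : \forall t \near (0 : R), U (L t).
  have line : L t @[t --> (0 : R)] --> L 0.
    apply: cvgD; first exact: cvg_cst.
    by apply: cvgZ; [exact: cvg_id|exact: cvg_cst].
  exact: line _ nU.
have BE t : U (L t) -> perimeter_set (@normals R) (L t) <-> phi (L t) = 0.
  move=> Ut.
  have : (perimeter_set (@normals R) `&` U) (L t) <-> (B0 `&` U) (L t).
    by rewrite BU.
  by rewrite B0E /setI /=; tauto.
have near0 : \forall t \near (0 : R), phi (L t) = 0.
  apply: real_analytic_line_eq0 => //.
  near=> t => t0; apply/BE; [by near: t|exact/Lin/ltW].
have : \forall t \near (0 : R), 0 <= t.
  near=> t; rewrite leNgt; apply/negP => /Lout; apply; apply/BE; by near: t.
move=> /nbhs_ballP[d /= d0 /(_ (- (d / 2)))]; rewrite /ball /= sub0r opprK.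
rewrite gtr0_norm ?divr_gt0 // => /(_ _); lra.
Unshelve. all: by end_near. Qed.
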